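(* Given a word $w$ of length $n$ over the alphabet $\{1,\ldots,n\}$ and the values $g(1),\ldots,g(n)$ of a function $g:\{1,\ldots,n\}\to\{1,\ldots,n\}$, one can find in ${\mathcal O}(n)$ time a gapped palindrome $u^Rvu$ (respectively, a gapped repeat $uvu$) occurring in $w$ with longest arm $u$ among those satisfying: if its right arm $u$ starts at position $i$, then $|v|\geq g(i)$.
   Context: A gapped repeat in $w$ is a factor of the form $uvu$, a gapped palindrome is a factor of the form $u^Rvu$, where $u^R$ is the reversal of $u$; $u$ is the arm and $v$ the gap. Computation model: unit-cost word RAM with logarithmic word size. *)

(* Defs.v *)
From mathcomp Require Import all_boot.

Set Implicit Arguments.
Unset Strict Implicit.
Unset Printing Implicit Defensive.

Variant gapped_kind := Palindrome | Repeat.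

Definition left_arm (K : gapped_kind) (u : seq nat) : seq nat :=
  match K with
  | Palindrome => rev u
  | Repeat => u
  end.

(** An occurrence is given by the triple (p, l, m): it starts at position [p]
    of [w] (positions are counted from 1), its arm has length [l] and its gap
    has length [m]; its right arm thus starts at position [p + l + m]. *)
Definition gapped_factor (K : gapped_kind) (w : seq nat) (p l m : nat) : Prop :=
  exists x u v y : seq nat,
    [/\ w = x ++ left_arm K u ++ v ++ u ++ y,
        (size x).+1 = p, size u = l & size v = m].

(** The bound [p + l + m <= size w] matters only for the empty arm, which
    could otherwise start just after the last letter, where [g] is undefined. *)
Definition admissible (K : gapped_kind) (w : seq nat) (g : nat -> nat)
    (p l m : nat) : Prop :=
  [/\ gapped_factor K w p l m, p + l + m <= size w & g (p + l + m) <= m].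

Definition longest_admissible (K : gapped_kind) (w : seq nat) (g : nat -> nat)
    (p l m : nat) : Prop :=
  admissible K w g p l m /\
  forall p' l' m', admissible K w g p' l' m' -> l' <= l.

(** Unit-cost word RAM: each instruction takes one step.
    A word of [b] bits is a natural number smaller than [2 ^ b].  A machine has
    registers, named by the instructions of its program (hence only finitely
    many are in use), and a memory addressed by words. *)

Variant binop := Add | Sub | Mul | Div | Mod | And | Or | Xor | Shl | Shr.

Variant instr :=
  | Const of nat & nat                 (* r := c *)
  | Move of nat & nat                  (* r := s *)
  | Op of binop & nat & nat & nat      (* r := s op t *)
  | Read of nat & nat                  (* r := mem[s] *)
  | Write of nat & nat                 (* mem[r] := s *)
  | Jmp of nat                         (* goto j *)
  | Jeq of nat & nat & nat             (* if r = s goto j *)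
  | Jlt of nat & nat & nat.            (* if r < s goto j *)

Definition program := seq instr.

Record config := Config {
  pc : nat;
  reg : nat -> nat;
  mem : nat -> nat
}.

(** Arithmetic is modulo [2 ^ b]; [x %/ 0 = 0] and [x %% 0 = x]. *)
Definition eval_binop (b : nat) (o : binop) (x y : nat) : nat :=
  (match o with
   | Add => x + y
   | Sub => x + (2 ^ b - y)
   | Mul => x * y
   | Div => x %/ y
   | Mod => x %% y
   | And => Nat.land x y
   | Or => Nat.lor x y
   | Xor => Nat.lxor x y
   | Shl => x * 2 ^ y
   | Shr => x %/ 2 ^ y
   end) %% 2 ^ b.

Definition upd (f : nat -> nat) (a x : nat) : nat -> nat :=
  fun a' => if a' == a then x else f a'.

Definition exec (b : nat) (c : instr) (s : config) : config :=
  let: Config i R M := s in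
  match c with
  | Const r x => Config i.+1 (upd R r (x %% 2 ^ b)) M
  | Move r r1 => Config i.+1 (upd R r (R r1)) M
  | Op o r r1 r2 => Config i.+1 (upd R r (eval_binop b o (R r1) (R r2))) M
  | Read r r1 => Config i.+1 (upd R r (M (R r1))) M
  | Write r r1 => Config i.+1 R (upd M (R r) (R r1))
  | Jmp j => Config j R M
  | Jeq r r1 j => Config (if R r == R r1 then j else i.+1) R M
  | Jlt r r1 j => Config (if R r < R r1 then j else i.+1) R M
  end.

(** The machine halts when the program counter leaves the program. *)
Definition halted (P : program) (s : config) : bool := size P <= pc s.

Definition step (b : nat) (P : program) (s : config) : config :=
  if halted P s then s else exec b (nth (Jmp 0) P (pc s)) s.

Definition steps (b : nat) (P : program) (t : nat) (s : config) : config :=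
  iter t (step b P) s.

(** [k] times the number of bits of [n]. *)
Definition word_size (k n : nat) : nat := k * up_log 2 n.+1.

(** Register 0 holds [n = size w], cells [1 .. n] hold the letters of [w], cells
    [n + 1 .. 2 n] hold [g 1, ..., g n]; everything else is 0. *)
Definition init_config (w : seq nat) (g : nat -> nat) : config :=
  let n := size w in
  Config 0
    (fun r => if r == 0 then n else 0)
    (fun a => if 0 < a <= n then nth 0 w a.-1
              else if n < a <= n + n then g (a - n) else 0).

(** Register 0 tells whether an admissible occurrence exists; if so, registers
    1, 2 and 3 hold a longest one. *)
Definition reports_longest (K : gapped_kind) (w : seq nat) (g : nat -> nat)
    (s : config) : Prop :=
  if reg s 0 == 0 then forall p l m, ~ admissible K w g p l m
  else longest_admissible K w g (reg s 1) (reg s 2) (reg s 3).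

(* Main.v *)
(** For a fixed arm length [l] and a fixed start [i] of the right arm [u], the
    gap is longest when the left arm ends as early as possible, and shortening
    an arm keeps it admissible.  So it suffices to slide over [w] a window that
    starts at [i] and has length [L + 1], where [L] is the longest arm found so
    far: if the earliest left arm for this window fits, [L] grows, and otherwise
    [i] does, so that the end of the window advances by one letter each time.

    Reading [u] backwards, a left arm starting or ending at a given place is
    a prefix of a suffix of [w] (palindromes) or of a reversed prefix of [w]
    (repeats).  We build Weiner's suffix tree of the reversal of [w ++ w]
    (repeats) or [rev w ++ w] (palindromes), whose suffixes include all these
    texts and all reversed windows; each node stores its earliest left arm, set
    by climbing from the texts in order until a node already has one.  Appending
    a letter to the window prepends it to the reversed window, which is
    followed in the tree by the same climbing as in Weiner's insertion: from the
    current node go up to the first node with a link for the letter.  The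
    number of nodes above [c :: u] is at most one more than above [u], so depth
    is a potential that pays for all climbing.  Links and children are found
    by direct addressing in a polynomially large zero-initialised memory, so
    that no sorting or hashing is needed. *)
Require Import Defs.
From mathcomp Require Import all_boot.
From mathcomp Require Import zify.

Set Implicit Arguments.
Unset Strict Implicit.
Unset Printing Implicit Defensive.

(** * A structured language with time credits and its compilation *)

(** The algorithm is written in a small structured language whose total-correctness judgement
    carries time credits, so that a potential is just a term of a loop invariant; one simulation
    result then converts credits into machine steps at a fixed rate.

    Only links between existing nodes are stored, none towards the inside of an edge. So when a new
    text leaves the tree in the middle of an edge, the place of the split cannot be read off a link.
    What saves the bound is that the tail of the missing node is already a node above the current
    leaf: a second climb finds it and is paid by the same fall in depth as the first.

    A reversed window usually ends inside an edge too. The query keeps the deepest node not longer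
    than the window and reads the answer at the lower end of the edge. This is sound because every
    left-arm text is itself a node: a text that enters an edge far enough to contain the window runs
    through the whole edge, so both ends of that part of the edge have the same earliest left
    arm. *)

Variant atom :=
  | Cst of nat & nat
  | Mov of nat & nat
  | Plus of nat & nat & nat
  | Minus of nat & nat & nat
  | Get of nat & nat & nat & option nat
  | Put of nat & nat & option nat & nat
  | Inp of nat & nat.

Variant test := Test of bool & bool & nat & nat.

Inductive cmd :=
  | Blk of seq atom
  | Sq of cmd & cmd
  | Cond of test & cmd & cmd
  | Loop of test & cmd.

Record state := State { var : nat -> nat; arr : nat -> nat -> nat -> nat }.

Definition upd3 (A : nat -> nat -> nat -> nat) a i j x : nat -> nat -> nat -> nat :=
  fun a' i' j' => if (a' == a) && ((j' == j) && (i' == i)) then x else A a' i' j'.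

Definition idx (R : nat -> nat) (j : option nat) := if j is Some q then R q else 0.

Definition holds (t : test) (s : state) : bool :=
  let: Test neg lt r1 r2 := t in
  neg (+) (if lt then var s r1 < var s r2 else var s r1 == var s r2).

Section Semantics.

Variables (n : nat) (inp : nat -> nat).

(** One bound for rows and computed values: the text has [2 n] letters and its tree at most
    [4 n + 1] nodes, and the sums that occur stay within a small multiple of [n]. *)
Definition lim := 16 * n.+1.

Definition run_atom (a : atom) (s : state) : state :=
  let: State R A := s in
  match a with
  | Cst r c => State (upd R r c) A
  | Mov r r1 => State (upd R r (R r1)) A
  | Plus r r1 r2 => State (upd R r (R r1 + R r2)) A
  | Minus r r1 r2 => State (upd R r (R r1 - R r2)) A
  | Get r a i j => State (upd R r (A a (R i) (idx R j))) A
  | Put a i j r => State R (upd3 A a (R i) (idx R j) (R r))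
  | Inp r i => State (upd R r (inp (R i))) A
  end.

(** These conditions rule out wrap-around, so that machine arithmetic is exact. Row 0 is forbidden
    because positive rows lie entirely behind the input cells [1 .. 2 n]; columns are letters. *)
Definition pre_atom (a : atom) (R : nat -> nat) : Prop :=
  match a with
  | Cst r c => c < 16
  | Mov r r1 => True
  | Plus r r1 r2 => R r1 + R r2 < lim
  | Minus r r1 r2 => R r2 <= R r1 < lim
  | Get r a i j => 0 < R i < lim /\ idx R j < n.+2
  | Put a i j r => 0 < R i < lim /\ idx R j < n.+2
  | Inp r i => 0 < R i <= n + n
  end.

Fixpoint wp (l : seq atom) (s : state) (Q : state -> Prop) : Prop :=
  if l is a :: l' then pre_atom a (var s) /\ wp l' (run_atom a s) Q else Q s.

Inductive runs : cmd -> state -> nat -> state -> Prop :=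
  | RunBlk l s s' : wp l s (fun s1 => s1 = s') -> runs (Blk l) s (size l) s'
  | RunSq c1 c2 s s1 s2 k1 k2 :
      runs c1 s k1 s1 -> runs c2 s1 k2 s2 -> runs (Sq c1 c2) s (k1 + k2) s2
  | RunCond t c1 c2 s s' k :
      runs (if holds t s then c1 else c2) s k s' -> runs (Cond t c1 c2) s k.+1 s'
  | RunStop t c s : ~~ holds t s -> runs (Loop t c) s 1 s
  | RunLoop t c s s1 s2 k1 k2 : holds t s -> runs c s k1 s1 ->
      runs (Loop t c) s1 k2 s2 -> runs (Loop t c) s (k1 + k2).+1 s2.

(** Total correctness with [k] time credits; the postcondition also receives
    the credits that are left. *)
Definition ok (c : cmd) (s : state) (k : nat) (Q : state -> nat -> Prop) : Prop :=
  exists k1 s', [/\ runs c s k1 s', k1 <= k & Q s' (k - k1)].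

Lemma ok_mono c s k (Q Q' : state -> nat -> Prop) :
  (forall s k, Q s k -> Q' s k) -> ok c s k Q -> ok c s k Q'.
Proof. by move=> QQ [k1 [s' [? ? /QQ ?]]]; exists k1, s'. Qed.

Lemma wp_ex l s (Q : state -> Prop) :
  wp l s Q -> exists2 s', wp l s (fun s1 => s1 = s') & Q s'.
Proof.
elim: l s => [|a l IH] s /=; first by exists s.
by case=> pa /IH [s' ? ?]; exists s'.
Qed.

Lemma ok_blk l s k Q :
  size l <= k -> wp l s (fun s' => Q s' (k - size l)) -> ok (Blk l) s k Q.
Proof.
by move=> lk /wp_ex [s' ? ?]; exists (size l), s'; split=> //; constructor.
Qed.

Lemma ok_seq c1 c2 s k Q :
  ok c1 s k (fun s' k' => ok c2 s' k' Q) -> ok (Sq c1 c2) s k Q.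
Proof.
case=> k1 [s1 [r1 le1 [k2 [s2 [r2 le2 q2]]]]].
exists (k1 + k2), s2; split; [exact: RunSq r1 r2 | lia | by rewrite subnDA].
Qed.

Lemma ok_blk_seq l c s k Q :
  size l <= k -> wp l s (fun s' => ok c s' (k - size l) Q) -> ok (Sq (Blk l) c) s k Q.
Proof. by move=> lk H; apply/ok_seq/ok_blk. Qed.

Lemma ok_cond t c1 c2 s k Q : 0 < k ->
  (holds t s -> ok c1 s k.-1 Q) -> (~~ holds t s -> ok c2 s k.-1 Q) ->
  ok (Cond t c1 c2) s k Q.
Proof.
move=> k0 H1 H2.
have [k1 [s' [r le q]]] : ok (if holds t s then c1 else c2) s k.-1 Q.
  by case: ifPn => [/H1|/H2].
exists k1.+1, s'; split; [exact: RunCond | lia | by rewrite (_ : k - k1.+1 = k.-1 - k1) //; lia].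
Qed.

(** The credits serve as the variant: the invariant keeps them positive and each test consumes one,
    so induction on them gives termination. *)
Lemma ok_loop t c (I : state -> nat -> Prop) s k Q :
  (forall s k, I s k -> 0 < k) ->
  (forall s k, I s k -> holds t s -> ok c s k.-1 I) ->
  (forall s k, I s k -> ~~ holds t s -> Q s k.-1) ->
  I s k -> ok (Loop t c) s k Q.
Proof.
move=> I0 IT IF; elim/ltn_ind: k s => k IH s Is.
have k0 := I0 _ _ Is.
case h: (holds t s); last first.
  by exists 1, s; split; rewrite ?subn1 //; [apply: RunStop; rewrite h | apply: IF; rewrite ?h].
have [k1 [s1 [r1 le1 q1]]] := IT _ _ Is h.
have [|k2 [s2 [r2 le2 q2]]] := IH (k.-1 - k1) _ s1 q1; first lia.
exists (k1 + k2).+1, s2; split; [exact: RunLoop r2 | lia |].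
by rewrite (_ : k - _ = k.-1 - k1 - k2) //; lia.
Qed.

End Semantics.

(** Machine register 32 holds [n + 2]; registers 33 and 34 are scratch. *)
Definition addr_code (a i : nat) (j : option nat) : seq instr :=
  [:: Op Mul 33 i 32;
      if j is Some q then Move 34 q else Const 34 0;
      Op Add 33 33 34;
      Const 34 16;
      Op Mul 33 33 34;
      Const 34 a;
      Op Add 33 33 34].

Definition atom_code (a : atom) : seq instr :=
  match a with
  | Cst r c => [:: Const r c]
  | Mov r r1 => [:: Move r r1]
  | Plus r r1 r2 => [:: Op Add r r1 r2]
  | Minus r r1 r2 => [:: Op Defs.Sub r r1 r2]
  | Get r a i j => rcons (addr_code a i j) (Read r 33)
  | Put a i j r => rcons (addr_code a i j) (Write 33 r)
  | Inp r i => [:: Read r i]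
  end.

Definition test_code (t : test) (jt jf : nat) : seq instr :=
  let: Test neg lt r1 r2 := t in
  let x := if neg then jf else jt in
  let y := if neg then jt else jf in
  [:: if lt then Jlt r1 r2 x else Jeq r1 r2 x; Jmp y].

Fixpoint code_size (c : cmd) : nat :=
  match c with
  | Blk l => size (flatten (map atom_code l))
  | Sq c1 c2 => code_size c1 + code_size c2
  | Cond t c1 c2 => (code_size c1 + code_size c2).+3
  | Loop t c => (code_size c).+3
  end.

(** Jumps are absolute, so the address [o] of the first instruction is a parameter. A conditional or
    a loop adds three instructions: two for the test and one jump. *)
Fixpoint compile (o : nat) (c : cmd) : seq instr :=
  match c with
  | Blk l => flatten (map atom_code l)
  | Sq c1 c2 => compile o c1 ++ compile (o + code_size c1) c2
  | Cond t c1 c2 =>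
      test_code t o.+2 (o + code_size c1).+3
      ++ compile o.+2 c1
      ++ Jmp (o + code_size c1 + code_size c2).+3
      :: compile (o + code_size c1).+3 c2
  | Loop t c =>
      test_code t o.+2 (o + code_size c).+3 ++ compile o.+2 c ++ [:: Jmp o]
  end.

Definition idx_ok (j : option nat) := if j is Some q then q < 32 else true.

Definition atom_ok (a : atom) : bool :=
  match a with
  | Cst r c => r < 32
  | Mov r r1 => (r < 32) && (r1 < 32)
  | Plus r r1 r2 | Minus r r1 r2 => [&& r < 32, r1 < 32 & r2 < 32]
  | Get r a i j | Put a i j r => [&& r < 32, a < 16, i < 32 & idx_ok j]
  | Inp r i => (r < 32) && (i < 32)
  end.

Definition test_ok (t : test) := let: Test _ _ r1 r2 := t in (r1 < 32) && (r2 < 32).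

Fixpoint cmd_ok (c : cmd) : bool :=
  match c with
  | Blk l => all atom_ok l
  | Sq c1 c2 => cmd_ok c1 && cmd_ok c2
  | Cond t c1 c2 => [&& test_ok t, cmd_ok c1 & cmd_ok c2]
  | Loop t c => test_ok t && cmd_ok c
  end.

Lemma size_compile o c : size (compile o c) = code_size c.
Proof.
elim: c o => [l|c1 IH1 c2 IH2|t c1 IH1 c2 IH2|t c IH] o //=.
- by rewrite size_cat IH1 IH2.
- by case: t => *; rewrite !size_cat /= IH1 IH2 !addnS.
- by case: t => *; rewrite !size_cat /= IH addn1.
Qed.

(** * Simulation of the structured language by the machine *)

Section Simulation.

Variables (n b : nat) (inp : nat -> nat) (P : program).
Hypothesis (big : (lim n * n.+2 + n.+2) * 16 + 16 < 2 ^ b).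

Definition addr a i j := (i * n.+2 + j) * 16 + a.

Lemma addr_inj a i j a' i' j' :
  a < 16 -> j < n.+2 -> a' < 16 -> j' < n.+2 ->
  (addr a i j == addr a' i' j') = (a == a') && ((j == j') && (i == i')).
Proof.
move=> la lj la' lj'; apply/eqP/and3P; last by case=> /eqP-> /eqP-> /eqP->.
rewrite /addr => e.
have ea : a = a'.
  by move/(congr1 (modn^~ 16)): e; rewrite !modnMDl !modn_small.
have e2 : i * n.+2 + j = i' * n.+2 + j' by lia.
have ej : j = j'.
  by move/(congr1 (modn^~ n.+2)): e2; rewrite !modnMDl !modn_small.
have ei : i = i' by move: e2; rewrite ej => /addIn /eqP; rewrite eqn_pmul2r // => /eqP.
by rewrite ea ej ei.
Qed.

Lemma addr_lt a i j : a < 16 -> i < lim n -> j < n.+2 -> addr a i j < 2 ^ b.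
Proof.
move=> la li lj; apply: leq_ltn_trans big; rewrite /addr.
have : i * n.+2 <= lim n * n.+2 by rewrite leq_mul2r ltnW ?orbT.
lia.
Qed.

Lemma addr_gt i a j : 0 < i -> n + n < addr a i j.
Proof.
move=> i0; rewrite /addr.
have : 1 * n.+2 <= i * n.+2 by rewrite leq_mul2r i0 orbT.
lia.
Qed.

(** Registers 33 and 34 are left free, since every address computation overwrites them. *)
Definition sim (s : state) (R M : nat -> nat) : Prop :=
  [/\ forall r, r < 32 -> R r = var s r,
      R 32 = n.+2,
      forall a i j, a < 16 -> 0 < i < lim n -> j < n.+2 -> M (addr a i j) = arr s a i j
    & forall i, 0 < i <= n + n -> M i = inp i].

Definition subcode (o : nat) (c : seq instr) : Prop :=
  exists p q, P = p ++ c ++ q /\ size p = o.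

Lemma subcode_cat o c1 c2 :
  subcode o (c1 ++ c2) -> subcode o c1 /\ subcode (o + size c1) c2.
Proof.
case=> p [q [e <-]]; split; first by exists p, (c2 ++ q); rewrite e -!catA.
by exists (p ++ c1), q; rewrite size_cat e -!catA.
Qed.

Lemma step_head o i c R M : subcode o (i :: c) ->
  step b P (Config o R M) = exec b i (Config o R M).
Proof.
case=> p [q [e <-]]; rewrite /step /halted e /= leqNgt size_cat /=.
by rewrite addnS ltnS leq_addr /= nth_cat ltnn subnn.
Qed.

Definition straight (i : instr) : bool :=
  match i with Jmp _ | Jeq _ _ _ | Jlt _ _ _ => false | _ => true end.

(** A straight instruction acts on registers and memory independently of the program counter, for
    which 0 stands. *)
Definition effect (x : (nat -> nat) * (nat -> nat)) (i : instr) :=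
  let s := exec b i (Config 0 x.1 x.2) in (reg s, Defs.mem s).

Lemma steps_straight o c x : all straight c -> subcode o c ->
  steps b P (size c) (Config o x.1 x.2) =
    let y := foldl effect x c in Config (o + size c) y.1 y.2.
Proof.
elim: c o x => [|i c IH] o x; first by rewrite addn0.
case/andP=> si sc; rewrite -cat1s => /subcode_cat [s1 s2].
rewrite /steps [size _]/= iterSr -/(steps _ _ _ _) (step_head _ _ s1).
have -> : exec b i (Config o x.1 x.2) = Config (o + 1) (effect x i).1 (effect x i).2.
  by rewrite addn1; case: (i) si => //= *.
by rewrite (IH _ _ sc s2) /= addn1 addSnnS.
Qed.

Lemma modS x : x < 2 ^ b -> x %% 2 ^ b = x. Proof. exact: modn_small. Qed.

Lemma lim_lt : lim n < 2 ^ b. Proof. by move: big; rewrite /lim; nia. Qed.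

Lemma addr_code_sim s R M a i j : sim s R M ->
  a < 16 -> i < 32 -> idx_ok j -> 0 < var s i < lim n -> idx (var s) j < n.+2 ->
  let y := foldl effect (R, M) (addr_code a i j) in
  [/\ y.1 33 = addr a (var s i) (idx (var s) j), y.2 = M
    & forall r, r <= 32 -> y.1 r = R r].
Proof.
case=> sR sN sM sI la li lj /andP[i0 il] jl.
set j' := idx _ _ in jl *.
have jE : (if j is Some q then R q else 0 %% 2 ^ b) = j'.
  by rewrite /j' /idx; case: (j) lj => [q|] /= lj; rewrite ?sR // mod0n.
have ub : (var s i * n.+2 + j') * 16 + a < 2 ^ b by exact: addr_lt.
have h16 : 16 < 2 ^ b by apply: leq_ltn_trans big; lia.
have e i' : effect (R, M) (Op Mul 33 i 32) = i' -> 
   i'.1 33 = var s i * n.+2 /\ i'.2 = M /\ forall r, r <= 32 -> i'.1 r = R r.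
  move=> <- /=; rewrite /eval_binop /upd /= sR // sN modS; last by lia.
  by split=> //; split=> // r lr; case: eqP => // ?; lia.
rewrite /addr_code; set X := (if j is Some q then _ else _).
rewrite -[foldl _ _ _]/(foldl effect (effect (effect (R, M) (Op Mul 33 i 32)) X)
  [:: Op Add 33 33 34; Const 34 16; Op Mul 33 33 34; Const 34 a; Op Add 33 33 34]).
case E: (effect _ (Op Mul _ _ _)) => [R1 M1]; have [e33 [eM e1]] := e _ E; rewrite /= in e33 eM e1; subst M1.
have -> : effect (R1, M) X = (upd R1 34 j', M).
  rewrite -jE /X; case: (j) lj => [q|] lj //=; rewrite /effect /= ?e1 //.
  exact: ltnW.
rewrite /effect /= /eval_binop /upd /= e33.
rewrite !(modS h16) (modS (_ : a < 2 ^ b)); last by lia.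
rewrite (modS (_ : var s i * n.+2 + j' < _)); last by lia.
rewrite (modS (_ : (var s i * n.+2 + j') * 16 < _)); last by lia.
rewrite (modS ub); split=> // r lr.
by do 8?(case: eqP => [?|_]; first lia); exact: e1.
Qed.

Lemma atom_sim a s R M : atom_ok a -> pre_atom n a (var s) -> sim s R M ->
  let y := foldl effect (R, M) (atom_code a) in sim (run_atom inp a s) y.1 y.2.
Proof.
have L := lim_lt.
case: s => V A; case: a => [r c|r r1|r r1 r2|r r1 r2|r a i j|a i j r|r i].
- move=> /= rr lc [sR sN sM sI]; split=> //=.
  + move=> r' lr; rewrite /upd; case: eqP => // _; first last; first exact: sR.
    by rewrite modS //; apply: leq_ltn_trans big; lia.
  + by rewrite /upd; case: eqP => // ?; lia.
- move=> /= /andP[rr rr1] _ [sR sN sM sI]; split=> //=.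
  + by move=> r' lr; rewrite /upd; case: eqP => // _; rewrite sR.
  + by rewrite /upd; case: eqP => // ?; lia.
- move=> /= /and3P[rr rr1 rr2] lc [sR sN sM sI]; split=> //=.
  + move=> r' lr; rewrite /upd /eval_binop; case: eqP => // _; rewrite !sR //=.
    by rewrite modS //; lia.
  + by rewrite /upd; case: eqP => // ?; lia.
- move=> /= /and3P[rr rr1 rr2] /andP[lc lc2] [sR sN sM sI]; split=> //=.
  + move=> r' lr; rewrite /upd /eval_binop; case: eqP => // _; rewrite !sR //=.
    have -> : V r1 + (2 ^ b - V r2) = V r1 - V r2 + 2 ^ b by lia.
    by rewrite modnDr modS //; lia.
  + by rewrite /upd; case: eqP => // ?; lia.
- case/and4P=> rr la li lj [hi hj] S.
  rewrite /atom_code -cats1 foldl_cat.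
  have [] := addr_code_sim S la li lj hi hj.
  case: (foldl _ _ (addr_code _ _ _)) => R1 M1 /= e33 eM e1; subst M1; case: S => sR sN sM sI; split=> //=.
  + move=> r' lr; rewrite /upd; case: eqP => // _; rewrite ?e33 ?sM //.
    by rewrite e1 ?sR // ltnW.
  + by rewrite /upd; case: eqP => [?|_]; [lia | rewrite e1].
- case/and4P=> rr la li lj [hi hj] S.
  rewrite /atom_code -cats1 foldl_cat.
  have [] := addr_code_sim S la li lj hi hj.
  case: (foldl _ _ (addr_code _ _ _)) => R1 M1 /= e33 eM e1; subst M1; case: S => sR sN sM sI; split=> //=.
  + by move=> r' lr; rewrite e1 ?sR // ltnW.
  + by rewrite e1.
  + move=> a' i' j' la' hi' lj'; rewrite /upd /upd3 e33 addr_inj // sM //.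
    by rewrite e1 1?ltnW // sR.
  + move=> i' hi'; rewrite /upd e33; case: eqP => [e|_]; last exact: sI.
    by case/andP: hi' => _; rewrite e leqNgt addr_gt //; case/andP: hi.
- move=> /= /andP[rr ri] hi [sR sN sM sI]; split=> //=.
  + by move=> r' lr; rewrite /upd; case: eqP => // _; rewrite sR // ?sI.
  + by rewrite /upd; case: eqP => // ?; lia.
Qed.

Lemma straight_atom a : all straight (atom_code a).
Proof. by case: a => // [r a i j|a i j r]; case: j. Qed.

Lemma size_atom_code a : size (atom_code a) <= 8. Proof. by case: a. Qed.

Lemma steps_add t1 t2 s : steps b P (t2 + t1) s = steps b P t2 (steps b P t1 s).
Proof. exact: iterD. Qed.

(** The rate 8 is the longest code of an atom: seven instructions for the address and one memory
    access. *)
Definition reaches (o : nat) (R M : nat -> nat) (k o' : nat) (s : state) : Prop :=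
  exists t R' M', [/\ t <= 8 * k, steps b P t (Config o R M) = Config o' R' M' & sim s R' M'].

Lemma blk_sim l s s' o R M : all atom_ok l -> wp n inp l s (fun s1 => s1 = s') ->
  sim s R M -> subcode o (flatten (map atom_code l)) ->
  reaches o R M (size l) (o + size (flatten (map atom_code l))) s'.
Proof.
elim: l s o R M => [|a l IH] s o R M /=.
  by move=> _ -> S _; exists 0, R, M; rewrite addn0.
case/andP=> oka okl [pa wl] S /subcode_cat [ca cl].
have [t [R' [M' [lt E S']]]] := IH _ _ _ _ okl wl (atom_sim oka pa S) cl.
exists (t + size (atom_code a)), R', M'; split=> //.
  by have := size_atom_code a; lia.
have E2 : steps b P (size (atom_code a)) (Config o R M) =
    Config (o + size (atom_code a)) (foldl effect (R, M) (atom_code a)).1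
      (foldl effect (R, M) (atom_code a)).2.
  exact: (steps_straight (R, M) (straight_atom a) ca).
by rewrite steps_add E2 E size_cat addnA.
Qed.

Lemma test_sim t s R M o jt jf : test_ok t -> sim s R M ->
  subcode o (test_code t jt jf) ->
  exists2 k, k <= 2 &
    steps b P k (Config o R M) = Config (if holds t s then jt else jf) R M.
Proof.
case: t => neg lt r1 r2 /andP[l1 l2] [sR _ _ _].
rewrite /= -!sR // => sc; rewrite -cat1s in sc.
have [s1 s2] := subcode_cat sc.
set x := if neg then jf else jt in s1 s2 sc; set y := if neg then jt else jf in s1 s2 sc.
set h := (if lt then _ else _).
have E : step b P (Config o R M) = Config (if h then x else o.+1) R M.
  by rewrite (step_head _ _ s1) /h; case: (lt).
have J : step b P (Config o.+1 R M) = Config y R M by rewrite addn1 in s2; rewrite (step_head _ _ s2).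
case hE: h E => E.
  by exists 1 => //; rewrite /steps /= E /x; case: (neg).
by exists 2 => //; rewrite /steps /= E J /y; case: (neg).
Qed.

Lemma runs_sim c s k s' : runs n inp c s k s' -> cmd_ok c ->
  forall o R M, sim s R M -> subcode o (compile o c) ->
  reaches o R M k (o + code_size c) s'.
Proof.
elim=> {c s k s'} [l s s' W|c1 c2 s s1 s2 k1 k2 _ IH1 _ IH2|t c1 c2 s s' k _ IH
                  |t c s H|t c s s1 s2 k1 k2 H _ IH1 _ IH2].
- by move=> okl o R M S sc; exact: (blk_sim okl W S sc).
- case/andP=> ok1 ok2 o R M S /= /subcode_cat; rewrite size_compile => -[sc1 sc2].
  have [t1 [R1 [M1 [le1 E1 S1]]]] := IH1 ok1 _ _ _ S sc1.
  have [t2 [R2 [M2 [le2 E2 S2]]]] := IH2 ok2 _ _ _ S1 sc2.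
  exists (t2 + t1), R2, M2; split=> //; first lia.
  by rewrite steps_add E1 E2 addnA.
- case/and3P=> okt ok1 ok2 o R M S /= /subcode_cat [sct].
  have -> : size (test_code t o.+2 (o + code_size c1).+3) = 2 by case: (t).
  rewrite addn2 => /subcode_cat; rewrite size_compile -cat1s => -[sc1 /subcode_cat [scj sc2]].
  have [kt lt Et] := test_sim okt S sct.
  case h: (holds t s) IH Et => IH Et.
    have [t1 [R1 [M1 [le1 E1 S1]]]] := IH ok1 _ _ _ S sc1.
    exists (1 + (t1 + kt)), R1, M1; split=> //; first lia.
    rewrite !steps_add Et E1 /steps /= (step_head _ _ scj) /=.
    by congr Config; lia.
  have sc2' : subcode (o + code_size c1).+3 (compile (o + code_size c1).+3 c2).
    by move: sc2; rewrite /= addn1 addSn addSn.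
  have [t1 [R1 [M1 [le1 E1 S1]]]] := IH ok2 _ _ _ S sc2'.
  exists (t1 + kt), R1, M1; split=> //; first lia.
  by rewrite !steps_add Et E1; congr Config; lia.
- case/andP=> okt okc o R M S /= /subcode_cat [sct _].
  have [kt lt] := test_sim okt S sct.
  rewrite (negbTE H) => Et; exists kt, R, M; split=> //; first lia.
  by rewrite Et; congr Config; lia.
- move=> okc; have /andP[okt okb] := okc => o R M S scl.
  have /= /subcode_cat [sct] := scl.
  have -> : size (test_code t o.+2 (o + code_size c).+3) = 2 by case: (t).
  rewrite addn2 => /subcode_cat; rewrite size_compile => -[sc1 scj].
  have [kt lt] := test_sim okt S sct; rewrite H => Et.
  have [t1 [R1 [M1 [le1 E1 S1]]]] := IH1 okb _ _ _ S sc1.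
  have [t2 [R2 [M2 [le2 E2 S2]]]] := IH2 okc _ _ _ S1 scl.
  exists (t2 + (1 + (t1 + kt))), R2, M2; split=> //; first lia.
  by rewrite !steps_add Et E1 -E2 /steps /= (step_head _ _ scj).
Qed.

End Simulation.

(** * Suffix trees under prepending a letter *)

Definition node_id (ns : seq (seq nat)) (u : seq nat) : nat := (index u ns).+2.

(** [ns] lists the nodes of a suffix tree of [x].  It may contain more nodes than
    needed: a node is inserted before the letter that makes it branch. *)
Record tree_shape (ns : seq (seq nat)) (x : seq nat) : Prop := TreeShape {
  shape_nil : node_id ns [::] = 2;
  shape_nil_in : [::] \in ns;
  shape_text : x \in ns;
  shape_fac : forall u, u \in ns -> infix u x;
  shape_behead : forall c u, c :: u \in ns -> u \in ns;
  shape_branch : forall u a b, a != b ->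
    infix (rcons u a) x -> infix (rcons u b) x -> u \in ns
}.

Definition child (ns : seq (seq nat)) (u v : seq nat) : Prop :=
  [/\ u \in ns, v \in ns, u = take (size u) v, size u < size v
    & forall k, size u < k < size v -> take k v \notin ns].

Lemma take_min (T : Type) i k (s t : seq T) : i <= k -> take k s = take k t -> take i s = take i t.
Proof. by move=> ik e; rewrite -(take_takel s ik) e take_takel. Qed.

Lemma infix_takel k (y x : seq nat) : infix y x -> infix (take k y) x.
Proof. exact: infix_trans (infix_take _ _). Qed.

Section Shape.

Variables (ns : seq (seq nat)) (x : seq nat).
Hypothesis sh : tree_shape ns x.

(** A first disagreement of [y] and [v] below [u] would be a branching factor strictly inside the
    edge, hence a node by [shape_branch]. *)
Lemma edge u v y k : child ns u v -> infix y x -> size u < size y ->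
  take (size u).+1 y = take (size u).+1 v ->
  k <= size y -> k <= size v -> take k y = take k v.
Proof.
case=> uN vN uv luv nb yx luy e; elim: k => [|k IH] ky kv; first by rewrite !take0.
case: (leqP k (size u)) => ku; first exact: take_min e.
have {}IH : take k y = take k v by apply: IH; lia.
rewrite !(take_nth 0) // IH; congr rcons; apply/eqP/negPn/negP => ne.
move: (nb k); rewrite ku kv => /(_ isT) /negP; apply.
apply: (shape_branch sh ne).
  by rewrite -IH -take_nth // infix_takel.
by rewrite -take_nth // infix_takel // (shape_fac sh).
Qed.

Lemma parent_ex v : v \in ns -> 0 < size v -> exists u, child ns u v.
Proof.
move=> vN v0.
have ex : exists k, (k < size v) && (take k v \in ns).
  by exists 0; rewrite v0 take0 (shape_nil_in sh).
have ub k : (k < size v) && (take k v \in ns) -> k <= size v by case/andP=> /ltnW.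
case: (ex_maxnP ex ub) => k /andP[kv kN] mx.
have sk : size (take k v) = k by rewrite size_takel // ltnW.
exists (take k v); split=> //; rewrite ?sk // => j /andP[kj jv].
by apply/negP => jN; move: (mx j); rewrite jv jN => /(_ isT); lia.
Qed.

Lemma drop_in k : drop k x \in ns.
Proof.
elim: k => [|k IH]; first by rewrite drop0 (shape_text sh).
case: (ltnP k (size x)) => kx.
  by apply: (shape_behead sh (c := nth 0 x k)); rewrite -drop_nth.
by rewrite drop_oversize 1?(shape_nil_in sh) // leqW.
Qed.

(** An occurrence of [rcons u a] extends to a suffix of [x], which is a node; the shortest node on
    the way to it is the child. *)
Lemma child_ex u a : u \in ns -> infix (rcons u a) x ->
  exists2 v, child ns u v & nth 0 v (size u) = a.
Proof.
move=> uN /infixP[p [s e]].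
set y := rcons u a ++ s in e.
have yN : y \in ns by have := drop_in (size p); rewrite e drop_size_cat.
have ex : exists k, (size u < k) && (take k y \in ns).
  by exists (size y); rewrite take_size yN size_cat size_rcons leq_addr.
case: (ex_minnP ex) => k /andP[uk kN] mn.
have ky : k <= size y.
  by apply: mn; rewrite take_size yN size_cat size_rcons leq_addr.
have sk : size (take k y) = k by rewrite size_takel.
exists (take k y); last first.
  by rewrite nth_take // /y nth_cat size_rcons leqnn nth_rcons ltnn eqxx.
split=> //; rewrite ?sk //.
  by rewrite take_takel 1?ltnW // /y -cats1 -catA take_size_cat.
move=> j /andP[uj jk]; rewrite take_takel 1?ltnW //; apply/negP => jN.
by have := mn j; rewrite uj jN => /(_ isT); lia.
Qed.

Lemma child_uniq u v v' : child ns u v -> child ns u v' ->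
  nth 0 v (size u) = nth 0 v' (size u) -> v = v'.
Proof.
move=> c c'; have [uN vN e l nb] := c; have [_ vN' e' l' nb'] := c'.
move=> en.
have e1 : take (size u).+1 v = take (size u).+1 v'.
  by rewrite !(take_nth 0) // en -e -e'.
have E k : k <= size v -> k <= size v' -> take k v = take k v'.
  exact: (edge c' (shape_fac sh vN) l e1).
case: (ltngtP (size v) (size v')) => s.
- have := nb' (size v); rewrite l s => /(_ isT).
  by rewrite -E // ?take_size ?vN // ltnW.
- have := nb (size v'); rewrite l' s => /(_ isT).
  by rewrite E // ?take_size ?vN' // ltnW.
- by rewrite -[v]take_size E // -?s // s take_size.
Qed.

Lemma parent_uniq u u' v : child ns u v -> child ns u' v -> u = u'.
Proof.
case=> uN _ e l nb [uN' _ e' l' nb'].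
case: (ltngtP (size u) (size u')) => s.
- by have := nb (size u'); rewrite s l' -e' uN' => /(_ isT).
- by have := nb' (size u); rewrite s l -e uN => /(_ isT).
- by rewrite e e' s.
Qed.

Lemma node_size u : u \in ns -> size u <= size x.
Proof. by move=> uN; apply: size_infix (shape_fac sh uN). Qed.

(** The new node need not branch; the closure under deleting the first letter is what asks for its
    tail [p] to be a node. *)
Lemma shape_split c p : p \in ns -> infix (c :: p) x -> tree_shape (rcons ns (c :: p)) x.
Proof.
move=> pN bx; have [s0 s1 s2 s3 s4 s5] := sh; split.
- by move: s0; rewrite /node_id -cats1 index_cat s1.
- by rewrite mem_rcons inE s1 orbT.
- by rewrite mem_rcons inE s2 orbT.
- by move=> u; rewrite mem_rcons inE => /orP[/eqP->|/s3].
- move=> d u; rewrite !mem_rcons !inE => /orP[/eqP[_ ->]|/s4 ->]; last by rewrite orbT.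
  by rewrite pN orbT.
- by move=> u a b ab ua ub; rewrite mem_rcons inE (s5 u a b) ?orbT.
Qed.

(** [take k (c :: x)] is the longest prefix of the new text that occurs in [x]. It is the only
    factor that can start to branch: after a shorter prefix the next letter was already seen in [x],
    and a longer one does not occur in [x]. *)
Lemma shape_leaf c k : k <= size x -> take k (c :: x) \in ns ->
  ~~ infix (take k.+1 (c :: x)) x -> tree_shape (rcons ns (c :: x)) (c :: x).
Proof.
move=> kx kN kI; have [s0 s1 s2 s3 s4 s5] := sh; split.
- by move: s0; rewrite /node_id -cats1 index_cat s1.
- by rewrite mem_rcons inE s1 orbT.
- by rewrite mem_rcons inE eqxx.
- move=> u; rewrite mem_rcons inE => /orP[/eqP->|/s3 ux]; first exact: infix_refl.
  by rewrite infix_consl ux orbT.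
- move=> d u; rewrite !mem_rcons !inE => /orP[/eqP[_ ->]|/s4 ->]; last by rewrite orbT.
  by rewrite s2 orbT.
- move=> u a b ab; rewrite !infix_consl mem_rcons inE => ua ub.
  (* A new branching has one continuation only at the start of the new text and the other one inside
     [x]. *)
  suff H d e : d != e -> prefix (rcons u d) (c :: x) -> ~~ infix (rcons u d) x ->
      infix (rcons u e) x -> u \in ns.
    case ia : (infix (rcons u a) x) ua => ua; case ib : (infix (rcons u b) x) ub => ub.
    - by rewrite (s5 u a b) ?orbT.
    - rewrite orbF in ub; rewrite (H b a) ?orbT ?ib //.
      by rewrite eq_sym.
    - by rewrite orbF in ua; rewrite (H a b) ?orbT ?ia.
    - rewrite !orbF in ua ub; move: ua ub; rewrite !prefixE !size_rcons => /eqP -> /eqP /rcons_inj[e].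
      by rewrite e eqxx in ab.
  move=> de ud nd ue.
  move: (ud); rewrite prefixE size_rcons => /eqP eud.
  have su : size u < size (c :: x) by have := size_prefix ud; rewrite size_rcons.
  have eu : take (size u) (c :: x) = u.
    by move: eud; rewrite (take_nth 0) // => /rcons_inj[].
  suff -> : u = take k (c :: x) by [].
  suff -> : k = size u by [].
  apply/eqP; rewrite eqn_leq; apply/andP; split.
    rewrite leqNgt; apply/negP => lt; case/negP: nd.
    by rewrite -eud -(take_takel (c :: x) lt) infix_takel // s3.
  rewrite leqNgt; apply/negP => lt; case/negP: kI.
  rewrite -(take_takel (c :: x) lt) eu.
  by apply: infix_takel; apply: infix_trans (infix_rcons u e) ue.
Qed.

End Shape.

(** * Edges of the tree after an insertion *)

Section Split.

Variables (ns : seq (seq nat)) (x q z : seq nat) (k : nat).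
Hypotheses (sh : tree_shape ns x) (qz : child ns q z) (kqz : size q < k < size z).

Let b := take k z.

Let szb : size b = k. Proof. by rewrite size_takel //; lia. Qed.

Lemma split_new : b \notin ns.
Proof. by case: qz => _ _ _ _; apply. Qed.

(** A child of [b] agrees with [z] below [q], so by [edge] it is [z]; a parent of [b] is [q], as no
    old node lies between [q] and [z]. *)
Lemma child_split u v : child (rcons ns b) u v ->
  [\/ u = q /\ v = b, u = b /\ v = z | child ns u v /\ v <> z].
Proof.
have [qN zN qe ql qnb] := qz; have /andP[qk kz] := kqz.
have bN := split_new.
case; rewrite !mem_rcons !inE => /orP[/eqP ub|uN] /orP[/eqP vb|vN] ue ul unb.
- by rewrite ub vb ltnn in ul.
- have l : size q < size v by rewrite ub szb in ul; lia.
  have e1 : take (size q).+1 v = take (size q).+1 z.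
    rewrite -[RHS](take_takel z qk) -/b -ub ue ub szb take_takel //.
  have E i : i <= size v -> i <= size z -> take i v = take i z.
    exact: (edge sh qz (shape_fac sh vN) l e1).
  have -> : v = z; last by constructor 2.
  case: (ltngtP (size v) (size z)) => s.
  + move: (qnb (size v)); rewrite l s => /(_ isT).
    by rewrite -E // ?take_size ?vN // ltnW.
  + move: (unb (size z)); rewrite ub szb kz s => /(_ isT).
    by rewrite E // ?take_size ?mem_rcons ?inE ?zN ?orbT // ltnW.
  + by rewrite -[v]take_size E // -?s // s take_size.
- constructor 1; split=> //.
  have uz : u = take (size u) z.
    by rewrite {1}ue vb take_takel //; move: ul; rewrite vb szb => /ltnW.
  have lu : size u < k by move: ul; rewrite vb szb.
  case: (ltngtP (size u) (size q)) => s; last by rewrite uz qe s.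
  + move: (unb (size q)); rewrite s vb szb qk => /(_ isT).
    by rewrite /b take_takel 1?ltnW // -qe mem_rcons inE qN orbT.
  + move: (qnb (size u)); rewrite s -uz uN => /(_ _)/negP-[] //.
    by rewrite (ltn_trans lu).
- have c : child ns u v.
    split=> // i /unb; rewrite mem_rcons inE negb_or; by case/andP.
  constructor 3; split=> // vz; move: c; rewrite vz => c.
  have eq : u = q := parent_uniq c qz.
  by move: (unb k); rewrite eq vz kqz mem_rcons inE eqxx => /(_ isT).
Qed.

End Split.

Section Leaf.

Variables (ns : seq (seq nat)) (x : seq nat) (c k : nat).
Hypotheses (sh : tree_shape ns x) (kx : k <= size x).
Hypotheses (kN : take k (c :: x) \in ns) (kI : ~~ infix (take k.+1 (c :: x)) x).

Lemma leaf_new : c :: x \notin ns.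
Proof. by apply/negP => /(node_size sh); rewrite ltnn. Qed.

(** The new text is longer than all old nodes, so it has no child; its parent has length at most
    [k], because no longer prefix occurs in [x], and at least [k], because [take k (c :: x)] is a
    node. *)
Lemma child_leaf u v : child (rcons ns (c :: x)) u v ->
  (u = take k (c :: x) /\ v = c :: x) \/ child ns u v.
Proof.
case; rewrite !mem_rcons !inE => uN /orP[/eqP vb|vN] ue ul unb.
  left; split=> //; move: uN => /orP[/eqP ux|uN].
    by move: ul; rewrite ux vb ltnn.
  rewrite vb in ue ul unb.
  have lu : size u <= size x by exact: node_size uN.
  case: (ltngtP (size u) k) => s; last by rewrite {1}ue s.
  + move: (unb k); rewrite s /= ltnS kx => /(_ isT).
    by rewrite mem_rcons inE kN orbT.
  + case/negP: kI; rewrite -(take_takel (c :: x) s) -ue.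
    by apply: infix_takel; exact: shape_fac uN.
right; move: uN => /orP[/eqP ux|uN].
  by have := node_size sh vN; move: ul; rewrite ux /=; lia.
by split=> // i /unb; rewrite mem_rcons inE negb_or; case/andP.
Qed.

End Leaf.

(** * Tables of the tree *)

Arguments node_id : simpl never.

(** Tables are indexed by nodes: 0 stands for no node, 1 for an extra parent of
    the root, and [node_id ns u] for the string [u].  [LEN] holds the length
    plus one, [PAR] the parent, [POS] some [t] such that the string is a prefix
    of [rev (take t cw)], [WLK] the node obtained by prepending a letter, [CHD]
    the child along a letter, and [MIN] the first left arm, plus one.  [TXT] and
    [LEAF] are indexed by positions in the text. *)
Notation TXT := 0 (only parsing).
Notation LEN := 1 (only parsing).
Notation POS := 2 (only parsing).
Notation PAR := 3 (only parsing).
Notation WLK := 4 (only parsing).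
Notation CHD := 5 (only parsing).
Notation LEAF := 6 (only parsing).
Notation MIN := 7 (only parsing).

Record tables (cw : seq nat) (ns : seq (seq nat)) (x : seq nat)
    (A : nat -> nat -> nat -> nat) : Prop := Tables {
  tab_len0 : A LEN 1 0 = 0;
  tab_len : forall u, u \in ns -> A LEN (node_id ns u) 0 = (size u).+1;
  tab_pos : forall u, u \in ns -> A POS (node_id ns u) 0 <= size x;
  tab_occ : forall u, u \in ns -> prefix u (rev (take (A POS (node_id ns u) 0) cw));
  tab_par0 : A PAR 2 0 = 1;
  tab_par : forall u v, child ns u v -> A PAR (node_id ns v) 0 = node_id ns u;
  tab_wlk0 : forall c, c \in x -> A WLK 1 c = 2;
  tab_wlk : forall u c, u \in ns ->
    A WLK (node_id ns u) c = if c :: u \in ns then node_id ns (c :: u) else 0;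
  tab_chd : forall u v, child ns u v ->
    A CHD (node_id ns u) (nth 0 v (size u)) = node_id ns v;
  tab_chd0 : forall u a, u \in ns -> ~~ infix (rcons u a) x -> A CHD (node_id ns u) a = 0;
  tab_new : forall i a, (size ns).+2 <= i -> A WLK i a = 0 /\ A CHD i a = 0
}.

Lemma node_id_inj ns u v : u \in ns -> (node_id ns u == node_id ns v) = (u == v).
Proof.
move=> uN; apply/eqP/eqP => [|-> //]; rewrite /node_id => -[e].
have vN : v \in ns by rewrite -index_mem -e index_mem.
by rewrite -(nth_index [::] uN) e nth_index.
Qed.

Lemma node_id_lt ns u : u \in ns -> node_id ns u < (size ns).+2.
Proof. by rewrite /node_id !ltnS index_mem. Qed.

Lemma node_id_neq ns u : u \in ns -> (node_id ns u == (size ns).+2) = false.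
Proof. by move/node_id_lt/ltn_eqF. Qed.

Lemma node_id_rcons ns b u : u \in ns -> node_id (rcons ns b) u = node_id ns u.
Proof. by rewrite /node_id -cats1 index_cat => ->. Qed.

Lemma node_id_last ns b : b \notin ns -> node_id (rcons ns b) b = (size ns).+2.
Proof. by rewrite /node_id -cats1 index_cat /= eqxx addn0 => /negbTE->. Qed.

Lemma child_in ns u v : child ns u v -> u \in ns /\ v \in ns. Proof. by case. Qed.

(** * Table updates for an insertion *)

Section Split.

Variables (cw : seq nat) (ns : seq (seq nat)) (x q p : seq nat) (z : seq nat) (c k : nat).
Variable A : nat -> nat -> nat -> nat.
Hypotheses (sh : tree_shape ns x) (tab : tables cw ns x A).
Hypotheses (qz : child ns q z) (kqz : size q < k < size z) (zk : take k z = c :: p).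
Hypothesis (pN : p \in ns).

Let m := (size ns).+2.

(** The writes are composed in the order of the program fragment, so that the two memories agree by
    unfolding. [POS] is inherited from [z], of which the new node is a prefix. *)
Definition split_arr : nat -> nat -> nat -> nat :=
  let A1 := upd3 A LEN m 0 k.+1 in
  let A2 := upd3 A1 POS m 0 (A POS (node_id ns z) 0) in
  let A3 := upd3 A2 PAR m 0 (node_id ns q) in
  let A4 := upd3 A3 PAR (node_id ns z) 0 m in
  let A5 := upd3 A4 CHD (node_id ns q) (nth 0 z (size q)) m in
  let A6 := upd3 A5 CHD m (nth 0 z k) (node_id ns z) in
  upd3 A6 WLK (node_id ns p) c m.

Lemma split_shape : tree_shape (rcons ns (take k z)) x.
Proof.
rewrite zk; apply: shape_split => //; rewrite -zk.
by case: qz => _ zN _ _ _; apply/infix_takel/(shape_fac sh).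
Qed.

Lemma split_tables : tables cw (rcons ns (take k z)) x split_arr.
Proof.
have [qN zN qe ql qnb] := qz; have /andP[qk kz] := kqz.
set b := take k z; have bN : b \notin ns := split_new qz kqz.
have bx : infix b x by apply/infix_takel/(shape_fac sh).
have szb : size b = k by rewrite size_takel // ltnW.
have idb := node_id_last bN; have idO := node_id_rcons b.
have mE u : u \in ns -> (m == node_id ns u) = false.
  by move=> uN; rewrite eq_sym node_id_neq.
have mem u : u \in rcons ns b -> u = b \/ u \in ns.
  by rewrite mem_rcons inE => /orP[/eqP|]; [left | right].
have id1 u : (1 == node_id ns u) = false by [].
have id2 : node_id ns [::] = 2 := shape_nil sh.
have z0 : (2 == node_id ns z) = false.
  by rewrite -id2 node_id_inj ?(shape_nil_in sh) //; apply/eqP => e; rewrite -e in ql.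
have qnz : (q == z) = false by apply/eqP => e; rewrite e ltnn in ql.
split; rewrite /split_arr.
- by rewrite /upd3 /= (tab_len0 tab).
- move=> u /mem [->|uN]; first by rewrite idb /upd3 /= eqxx szb.
  by rewrite idO // /upd3 /= node_id_neq // (tab_len tab).
- move=> u /mem [->|uN]; first by rewrite idb /upd3 /= eqxx /= (tab_pos tab).
  by rewrite idO // /upd3 /= node_id_neq // (tab_pos tab).
- move=> u /mem [->|uN].
    rewrite idb /upd3 /= eqxx /=; apply: prefix_trans (tab_occ tab zN).
    exact: prefix_take.
  by rewrite idO // /upd3 /= node_id_neq // (tab_occ tab).
- by rewrite /upd3 /= z0 -id2 node_id_neq ?(shape_nil_in sh) //= id2 (tab_par0 tab).
- move=> u v /(child_split sh qz kqz) [[-> ->]|[-> ->]|[cuv vz]].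
  + by rewrite idb idO // /upd3 /= mE // eqxx.
  + by rewrite idb idO // /upd3 /= eqxx.
  + have [uN vN] := child_in cuv.
    rewrite !idO // /upd3 /= node_id_inj // node_id_neq //.
    by case: eqP => // _; rewrite /= (tab_par tab cuv).
- by move=> d dx; rewrite /upd3 /= id1 andbF (tab_wlk0 tab).
- move=> u d /mem [->|uN].
    (* [d :: b] would have the tail [b], which was not a node before; this agrees with the still
       blank row of the fresh node. *)
    have -> : d :: b \in rcons ns b = false.
      rewrite mem_rcons inE; apply/negbTE; rewrite negb_or.
      rewrite (negbTE (_ : d :: b != b)); last by apply/eqP => /(congr1 size)/=; lia.
      by apply/negP => /(shape_behead sh); rewrite (negbTE bN).
    by rewrite idb /upd3 /= mE // andbF; have [] := tab_new tab d (leqnn m).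
  rewrite idO // mem_rcons inE /upd3 /= node_id_inj //.
  have -> : (d :: u == b) = (d == c) && (u == p) by rewrite /b zk eqseq_cons.
  case: ifP => [/andP[/eqP-> /eqP->]|_].
    by rewrite -[c :: p]zk idb.
  rewrite (tab_wlk tab) //; case: ifP => [dN|//]; by rewrite idO.
- move=> u v /(child_split sh qz kqz) [[-> ->]|[-> ->]|[cuv vz]].
  + by rewrite idb idO // /upd3 /= eqxx /b nth_take // eqxx node_id_neq // andbF.
  + by rewrite idb idO // /upd3 /= !eqxx szb eqxx.
  + have [uN vN] := child_in cuv.
    rewrite !idO // /upd3 /= node_id_inj // node_id_neq // andbF.
    case: ifP => [/andP[/eqP e /eqP uq]|_]; last by rewrite (tab_chd tab cuv).
    case: vz; rewrite uq in cuv e; exact: (child_uniq sh cuv qz e).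
- move=> u a /mem [->|uN] H.
    rewrite idb /upd3 /= eqxx andbT mE // andbF; case: eqP => [e|_].
      by case/negP: H; rewrite e -take_nth // infix_takel // (shape_fac sh).
    by have [] := tab_new tab a (leqnn m).
  rewrite idO // /upd3 /= node_id_inj // node_id_neq // andbF.
  case: ifP => [/andP[/eqP e /eqP uq]|_]; last by rewrite (tab_chd0 tab).
  case/negP: H; rewrite uq e {1}qe -take_nth //.
  by rewrite infix_takel // (shape_fac sh).
- move=> i a; rewrite size_rcons => mi.
  have mi' : (size ns).+2 <= i by lia.
  have ne u : u \in ns -> (i == node_id ns u) = false.
    by move/node_id_lt => l; rewrite gtn_eqF // (leq_trans l).
  have nm : (i == m) = false by apply/eqP; rewrite /m; lia.
  by rewrite /upd3 /= !ne // nm !andbF; exact: (tab_new tab).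
Qed.

End Split.

Section Leaf.

Variables (cw : seq nat) (ns : seq (seq nat)) (x : seq nat) (c k : nat).
Variable A : nat -> nat -> nat -> nat.
Hypotheses (sh : tree_shape ns x) (tab : tables cw ns x A).
Hypotheses (cx : c :: x = rev (take (size x).+1 cw)) (c1 : A WLK 1 c = 2).
Hypotheses (kx : k <= size x) (kN : take k (c :: x) \in ns).
Hypothesis (kI : ~~ infix (take k.+1 (c :: x)) x).

Let m := (size ns).+2.

Definition leaf_arr : nat -> nat -> nat -> nat :=
  let A1 := upd3 A LEN m 0 (size x).+2 in
  let A2 := upd3 A1 POS m 0 (size x).+1 in
  let A3 := upd3 A2 PAR m 0 (node_id ns (take k (c :: x))) in
  let A4 := upd3 A3 CHD (node_id ns (take k (c :: x))) (nth 0 (c :: x) k) m in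
  let A5 := upd3 A4 WLK (node_id ns x) c m in
  upd3 A5 LEAF (size x).+1 0 m.

Lemma leaf_shape : tree_shape (rcons ns (c :: x)) (c :: x).
Proof. exact: (shape_leaf sh kx). Qed.

Lemma leaf_tables : tables cw (rcons ns (c :: x)) (c :: x) leaf_arr.
Proof.
have xN := shape_text sh.
have bN := leaf_new c sh.
set y := c :: x in bN *; set b := take k y.
have bIn : b \in ns := kN.
have szb : size b = k by rewrite size_takel //= leqW.
have idb := node_id_last bN; have idO := node_id_rcons y.
have mE u : u \in ns -> (m == node_id ns u) = false.
  by move=> uN; rewrite eq_sym node_id_neq.
have mem u : u \in rcons ns y -> u = y \/ u \in ns.
  by rewrite mem_rcons inE => /orP[/eqP|]; [left | right].
have kE : take k.+1 y = rcons b (nth 0 y k) by rewrite -take_nth //= ltnS.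
split; rewrite /leaf_arr.
- by rewrite /upd3 /= (tab_len0 tab).
- move=> u /mem [->|uN]; first by rewrite idb /upd3 /= eqxx.
  by rewrite idO // /upd3 /= node_id_neq // (tab_len tab).
- move=> u /mem [->|uN]; first by rewrite idb /upd3 /= eqxx.
  by rewrite idO // /upd3 /= node_id_neq // leqW // (tab_pos tab).
- move=> u /mem [->|uN]; first by rewrite idb /upd3 /= eqxx /= -cx prefix_refl.
  by rewrite idO // /upd3 /= node_id_neq // (tab_occ tab).
- by rewrite /upd3 /= -(shape_nil sh) node_id_neq ?(shape_nil_in sh) //= (shape_nil sh) (tab_par0 tab).
- move=> u v /(child_leaf sh kx kN kI) [[-> ->]|cuv].
    by rewrite idb idO // /upd3 /= eqxx.
  have [uN vN] := child_in cuv.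
  by rewrite !idO // /upd3 /= node_id_neq //= (tab_par tab cuv).
- by move=> d; rewrite /upd3 /= andbF inE => /orP[/eqP->|/(tab_wlk0 tab)].
- move=> u d /mem [->|uN].
    have -> : d :: y \in rcons ns y = false.
      rewrite mem_rcons inE; apply/negbTE; rewrite negb_or.
      rewrite (negbTE (_ : d :: y != y)); last by apply/eqP => /(congr1 size)/=; lia.
      by apply/negP => /(shape_behead sh); rewrite (negbTE bN).
    by rewrite idb /upd3 /= mE // andbF; have [] := tab_new tab d (leqnn m).
  rewrite idO // mem_rcons inE /upd3 /= node_id_inj // /y eqseq_cons andbC.
  case: ifP => [/andP[/eqP-> /eqP->]|_]; first by rewrite idb.
  rewrite (tab_wlk tab) //=; case: ifP => [dN|//]; by rewrite idO.
- move=> u v /(child_leaf sh kx kN kI) [[-> ->]|cuv].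
    by rewrite idb idO // /upd3 /= szb !eqxx.
  have [uN vN] := child_in cuv.
  rewrite !idO // /upd3 /= node_id_inj //=.
  case: ifP => [/andP[/eqP e /eqP ub]|_]; last by rewrite (tab_chd tab cuv).
  case/negP: kI; have -> : take k.+1 (c :: x) = rcons u (nth 0 v (size u)).
    by rewrite e ub [LHS]kE.
  case: cuv => _ _ ue l _.
  by rewrite {1}ue -take_nth // infix_takel // (shape_fac sh).
- move=> u a /mem [->|uN] H.
    rewrite idb /upd3 /= mE // andbF.
    by have [] := tab_new tab a (leqnn m).
  rewrite idO // /upd3 /= node_id_inj //=.
  case: ifP => [/andP[/eqP e /eqP uq]|_].
    by case/negP: H; rewrite uq e -kE infix_takel // infix_refl.
  apply: (tab_chd0 tab) => //; apply: contra H => H.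
  by rewrite infix_consl H orbT.
- move=> i a; rewrite size_rcons => mi.
  have mi' : (size ns).+2 <= i by lia.
  have ne u : u \in ns -> (i == node_id ns u) = false.
    by move/node_id_lt => l; rewrite gtn_eqF // (leq_trans l).
  by rewrite /upd3 /= !ne // !andbF; exact: (tab_new tab).
Qed.

End Leaf.

(** Climbing from a node [v] towards the root visits the nodes that are
    prefixes of [v], then the node 1, an extra parent of the root.  As the letter
    links of [u] lead to the node [c :: u], it is convenient to let level [k]
    be the prefix of length [k - 1], and level 0 the node 1. *)
Definition level (ns : seq (seq nat)) (s : seq nat) (k : nat) : bool :=
  (k == 0) || (take k.-1 s \in ns).

Definition level_id (ns : seq (seq nat)) (s : seq nat) (k : nat) : nat :=
  if k is k1.+1 then node_id ns (take k1 s) else 1.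

(** This is the number of parent steps from level [k] to the node 1. *)
Definition depth (ns : seq (seq nat)) (s : seq nat) (k : nat) : nat :=
  count (fun j => take j s \in ns) (iota 0 k).

Lemma depthS ns s k : depth ns s k.+1 = depth ns s k + (take k s \in ns).
Proof. by rewrite /depth -addn1 iotaD count_cat /= add0n addn0. Qed.

Lemma depth_le ns s k k' : k <= k' -> depth ns s k <= depth ns s k'.
Proof. by move/subnKC <-; rewrite /depth iotaD count_cat leq_addr. Qed.

Lemma depth_lt ns s k k' : k' < k -> level ns s k -> depth ns s k' < depth ns s k.
Proof.
case: k => // k; rewrite ltnS /level /= => kk' kN.
by rewrite depthS kN addn1 ltnS depth_le.
Qed.

(** Deleting the first letter maps the nodes above [c :: u] to nodes above [u]. *)
Lemma depth_cons ns x c s k : tree_shape ns x ->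
  depth ns (c :: s) k.+1 <= (depth ns s k).+1.
Proof.
move=> sh; rewrite /depth /= (iotaDl 1 0 k : iota 1 k = _) count_map -[leqRHS]add1n.
rewrite leq_add ?leq_b1 // sub_count // => j /=.
exact: (shape_behead sh).
Qed.

Section Levels.

Variables (cw : seq nat) (ns : seq (seq nat)) (x s : seq nat) (A : nat -> nat -> nat -> nat).
Hypotheses (sh : tree_shape ns x) (tab : tables cw ns x A).

Lemma level_par k : level ns s k -> 0 < k <= (size s).+1 ->
  exists2 k', [/\ k' < k, level ns s k' & A PAR (level_id ns s k) 0 = level_id ns s k']
    & forall j, k' < j < k -> ~~ level ns s j.
Proof.
case: k => // k; rewrite /level /= ltnS => kN ks.
case: k kN ks => [|k] kN ks.
  by exists 0; [split; rewrite // take0 (shape_nil sh) (tab_par0 tab) | move=> j; lia].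
have sk : size (take k.+1 s) = k.+1 by rewrite size_takel.
have [|u cu] := parent_ex sh kN; first by rewrite sk.
have [uN _ ue ul nb] := cu; rewrite sk in ul nb.
have ut : u = take (size u) s by rewrite {1}ue take_takel // ltnW.
exists (size u).+1; first by split; rewrite //= /level /= -?ut ?(tab_par tab cu) ?ltnS.
move=> [|j] //= /andP[uj jk].
by rewrite /level /= -(take_takel s (ltnW (jk : j < k.+1))) nb // -ltnS uj.
Qed.

Lemma level_len k : level ns s k -> k <= (size s).+1 -> A LEN (level_id ns s k) 0 = k.
Proof.
case: k => [|k]; rewrite /level /= ?(tab_len0 tab) // => kN ks.
by rewrite (tab_len tab) // size_takel.
Qed.

Lemma level_wlk c k : A WLK 1 c = 2 -> level ns s k ->
  A WLK (level_id ns s k) c =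
    if take k (c :: s) \in ns then node_id ns (take k (c :: s)) else 0.
Proof.
case: k => [|k] c1; rewrite /level /= => kN; last by rewrite (tab_wlk tab).
by rewrite (shape_nil_in sh) (shape_nil sh).
Qed.

Lemma level_id_gt0 k : 0 < level_id ns s k. Proof. by case: k. Qed.

Lemma level_id_lt k : level ns s k -> level_id ns s k < (size ns).+2.
Proof. by case: k => // k; rewrite /level /=; apply: node_id_lt. Qed.

Lemma level_behead c k : take k (c :: s) \in ns -> level ns s k.
Proof. by case: k => // k; rewrite /level /= => /(shape_behead sh). Qed.

End Levels.

Lemma depth_top ns s a b : (forall j, a <= j < b -> take j s \notin ns) ->
  depth ns s b <= depth ns s a.
Proof.
elim: b => [|b IH] H; first by rewrite (leq_trans (depth_le _ _ (leq0n a))).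
case: (leqP a b) => ab; last exact: depth_le.
rewrite depthS (negbTE (H b _)) ?ab //= addn0 IH // => j /andP[aj jb].
by rewrite H // aj ltnW.
Qed.

(** Prefixes of different lengths differ, so the new node is counted at most once. *)
Lemma depth_rcons ns b s k : k <= (size s).+1 ->
  depth (rcons ns b) s k <= (depth ns s k).+1.
Proof.
elim: k => [|k IH] ks //.
rewrite !depthS mem_rcons inE; case: eqP => [e|_] /=; last first.
  by rewrite -addSn leq_add2r IH // ltnW.
rewrite addn1 ltnS (leq_trans _ (leq_addr _ _)) //.
have H (j : nat) : j \in iota 0 k -> (take j s \in rcons ns b) = (take j s \in ns).
  rewrite mem_iota add0n /= => jk; rewrite mem_rcons inE.
  case: eqP => // e'; have := congr1 size (etrans e' (esym e)).
  by rewrite !size_takel ?(ltnW (leq_trans jk _)) // => jk'; rewrite jk' ltnn in jk.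
by rewrite /depth (eq_in_count H).
Qed.

(** * The place where the new text leaves the tree *)

Section Head.

Variables (ns : seq (seq nat)) (x : seq nat) (c k : nat).
Hypotheses (sh : tree_shape ns x) (kN : take k (c :: x) \in ns) (kx1 : k <= (size x).+1).
Hypothesis above : forall j, k < j <= (size x).+1 -> take j (c :: x) \notin ns.

Lemma head_le : k <= size x.
Proof.
move: kx1; rewrite leq_eqVlt => /orP[/eqP e|//].
by have := leaf_new c sh; rewrite -(take_size (c :: x)) -[size (c :: x)]e kN.
Qed.

(** [kb] is the length of the longest common prefix of [v] and the new text. Without its first
    letter, this common prefix is followed in [x] by two different letters, at the start of [x] and
    inside [v], hence it is a node. So the split point shows up among the levels above the leaf
    [x]. *)
Lemma head_split v : child ns (take k (c :: x)) v -> nth 0 v k = nth 0 (c :: x) k ->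
  exists kb, [/\ k < kb < size v, kb <= size x /\ level ns x kb,
    take kb v = take kb (c :: x), nth 0 (c :: x) kb <> nth 0 v kb
    & ~~ infix (take kb.+1 (c :: x)) x].
Proof.
move=> cv e; have [_ vN ue ul nb] := cv; have kx := head_le.
have sk : size (take k (c :: x)) = k by rewrite size_takel.
rewrite sk in ue ul nb.
have vx : size v <= size x := node_size sh vN.
have E1 : take k.+1 v = take k.+1 (c :: x).
  by rewrite !(take_nth 0) // e -ue.
have ex : exists j, take j v != take j (c :: x).
  exists (size v); rewrite take_size; apply/eqP => ev.
  by have := above (j := size v); rewrite ul -ev vN leqW // => /(_ isT).
case: (ex_minnP ex) => -[|kb] ne mn; first by rewrite !take0 in ne.
have kkb : k < kb.
  by rewrite ltnNge; apply/negP => le; case/eqP: ne; apply: (take_min _ E1).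
have E : take kb v = take kb (c :: x).
  by apply/eqP/negPn/negP => /mn; rewrite ltnn.
have kv : kb < size v.
  rewrite ltnNge; apply/negP => le.
  have := above (j := size v); rewrite ul leqW // -(take_min le E) take_size vN.
  by move/(_ isT).
have kbx : kb < (size x).+1 by lia.
have ne' : nth 0 (c :: x) kb <> nth 0 v kb.
  by move=> en; case/eqP: ne; rewrite !(take_nth 0) //= -en E.
have vb : infix (take kb.+1 v) x by apply/infix_takel/(shape_fac sh).
exists kb; split=> //; first by rewrite kkb.
  split=> //; case: kb kkb {mn ne} kv kbx E ne' vb => // kb _ kv kbx E ne' vb.
  rewrite /level /=; have /eqP/negPf ne2 := ne'.
  apply: (shape_branch sh (a := nth 0 x kb) (b := nth 0 v kb.+1)).
  - by apply/eqP.
  - by rewrite -take_nth ?infix_take.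
  - by move: vb; rewrite (take_nth 0 kv) E; exact: consl_infix.
apply/negP => ix.
have ne2 : k < size (take kb.+1 (c :: x)) by rewrite size_takel //; lia.
have e1 : take k.+1 (take kb.+1 (c :: x)) = take k.+1 v.
  by rewrite take_takel ?E1 // ltnS ltnW.
have E3 : take kb.+1 (take kb.+1 (c :: x)) = take kb.+1 v.
  by apply: (edge sh cv ix); rewrite ?sk // size_takel.
apply: ne'; move: E3; rewrite take_takel // (take_nth 0 kv).
by rewrite (take_nth 0 (kbx : kb < size (c :: x))) => /rcons_inj[].
Qed.

End Head.

(** * Building the tree *)

Arguments lim : simpl never.

Notation rN := 0 (only parsing).
Notation rFound := 4 (only parsing).
Notation rL := 5 (only parsing).
Notation rZero := 6 (only parsing).
Notation rOne := 7 (only parsing).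
Notation rTwo := 8 (only parsing).
Notation rNN := 9 (only parsing).
Notation rT := 10 (only parsing).
Notation rT1 := 11 (only parsing).
Notation rLeaf := 12 (only parsing).
Notation rNew := 13 (only parsing).
Notation rC := 14 (only parsing).
Notation rY := 15 (only parsing).
Notation rQ := 16 (only parsing).
Notation rK := 17 (only parsing).
Notation rA := 18 (only parsing).
Notation rZ := 19 (only parsing).
Notation rLz := 20 (only parsing).
Notation rPz := 21 (only parsing).
Notation rY2 := 22 (only parsing).
Notation rP := 23 (only parsing).
Notation rB := 24 (only parsing).
Notation rE := 25 (only parsing).
Notation rF := 26 (only parsing).

Definition climb : cmd :=
  Sq (Blk [:: Get rQ WLK rY (Some rC)])
     (Loop (Test false false rQ rZero)
        (Blk [:: Get rY PAR rY None; Get rQ WLK rY (Some rC)])).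

Section Climb.

Variables (n : nat) (inp : nat -> nat) (cw : seq nat) (ns : seq (seq nat)) (x s : seq nat).
Variables (c : nat) (V : nat -> nat) (A : nat -> nat -> nat -> nat) (k0 R K : nat).
Hypotheses (sh : tree_shape ns x) (tab : tables cw ns x A).
Hypotheses (nsl : (size ns).+2 <= lim n) (cn : c < n.+2) (c1 : A WLK 1 c = 2).
Hypotheses (V6 : V rZero = 0) (VC : V rC = c) (VY : V rY = level_id ns s k0).
Hypotheses (lk0 : level ns s k0) (k0s : k0 <= (size s).+1).
Hypothesis KR : 3 * depth ns s k0 + R + 2 <= K.

(** A round costs three credits, for the test and two atoms, and rises by at least one node, so
    [depth] pays for it. The climb stops at node 1 at the latest, whose link for [c] is the root.
    [R] stands for credits reserved by the caller. *)
Lemma climb_ok : ok n inp climb (State V A) K (fun st K' => exists V' k,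
  [/\ st = State V' A /\ k <= k0, V' rY = level_id ns s k /\ level ns s k,
      take k (c :: s) \in ns /\ V' rQ = node_id ns (take k (c :: s)),
      forall j, k < j <= k0 -> take j (c :: s) \notin ns
    & (forall r, r != rY -> r != rQ -> V' r = V r) /\ 3 * depth ns s k + R <= K']).
Proof.
have idl k : level ns s k -> 0 < level_id ns s k < lim n.
  by move=> lk; rewrite level_id_gt0 (leq_trans (level_id_lt lk)).
apply: ok_blk_seq; first by rewrite /=; lia.
rewrite /= /upd /= VY VC idl //; split=> //.
pose I st K' := exists V' k, [/\ st = State V' A /\ k <= k0, V' rY = level_id ns s k /\ level ns s k,
      V' rQ = A WLK (level_id ns s k) c,
      forall j, k < j <= k0 -> take j (c :: s) \notin ns
    & (forall r, r != rY -> r != rQ -> V' r = V r) /\ 3 * depth ns s k + R + 1 <= K'].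
apply: (ok_loop (I := I)).
- by move=> st K' [V' [k [_ _ _ _ [_]]]]; lia.
- move=> st K' [V' [k [[-> kk0] [Vy lk] Vq nk [fr cr]]]] /=.
  rewrite Vq fr // V6 (level_wlk sh tab) //; case: ifP => // kN _.
  have k_gt0 : 0 < k by case: k kN {kk0 Vy lk Vq nk cr} => //; rewrite take0 (shape_nil_in sh).
  have [|k' [kk' lk' pk] nk'] := level_par sh tab lk.
    by rewrite k_gt0 (leq_trans kk0).
  apply: ok_blk; first by move: (depth_lt kk' lk) cr => /=; lia.
  rewrite /= /upd /= Vy pk !fr // VC !idl //; do 2!split=> //.
  set V2 := fun a' => _; exists V2, k'; split=> //.
  + by split=> //; lia.
  (* The levels jumped over are not nodes, so by [shape_behead] neither are their extensions by
     [c]. *)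
  + move=> j /andP[kj jk]; case: (ltngtP k j) => kj'.
    * by apply: nk; rewrite kj'.
    * apply: contra (nk' j _) => [jN|]; last by rewrite kj.
      exact: (level_behead sh jN).
    * by rewrite -kj' kN.
  + split=> [r r1 r2|]; first by rewrite /V2 (negbTE r1) (negbTE r2) fr.
    by move: (depth_lt kk' lk) cr => /=; lia.
- move=> st K' [V' [k [[-> kk0] [Vy lk] Vq nk [fr cr]]]] /=.
  rewrite Vq fr // V6 (level_wlk sh tab) //; case: ifP => // kN _.
  exists V', k; split=> //; first by rewrite Vq (level_wlk sh tab) // kN.
  by split=> //; lia.
- set V2 := fun a' => _; exists V2, k0; split=> //.
    by move=> j; lia.
  split=> [r r1 r2|]; first by rewrite /V2 (negbTE r2).
  by rewrite /=; lia.
Qed.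

End Climb.

(** The new text leaves the edge towards the node [rZ] after a string whose
    tail is a node above the leaf.  Below the node reached by [climb] it is the
    highest node where the two texts differ in the next letter, hence the last
    one found by a second climb from the leaf. *)
Definition scan_step : cmd :=
  Sq (Blk [:: Get rK LEN rY2 None])
 (Sq (Cond (Test false true rK rLz)
       (Sq (Blk [:: Minus rE rPz rK; Get rE TXT rE None; Minus rF rT1 rK; Get rF TXT rF None])
           (Cond (Test true false rE rF) (Blk [:: Mov rP rY2]) (Blk [::])))
       (Blk [::]))
     (Blk [:: Get rY2 PAR rY2 None])).

Definition split_head : cmd :=
  Sq (Blk [:: Get rLz LEN rZ None; Minus rLz rLz rOne; Get rPz POS rZ None; Mov rY2 rLeaf])
 (Sq (Loop (Test true false rY2 rY) scan_step)
     (Blk [:: Get rK LEN rP None; Plus rE rK rOne; Put LEN rNew None rE; Put POS rNew None rPz;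
              Put PAR rNew None rQ; Put PAR rZ None rNew; Put CHD rQ (Some rA) rNew;
              Minus rE rPz rK; Get rE TXT rE None; Put CHD rNew (Some rE) rZ;
              Put WLK rP (Some rC) rNew; Mov rB rNew; Plus rNew rNew rOne;
              Minus rE rT1 rK; Get rA TXT rE None])).

Definition add_leaf : seq atom :=
  [:: Plus rE rT1 rOne; Put LEN rNew None rE; Put POS rNew None rT1; Put PAR rNew None rB;
      Put CHD rB (Some rA) rNew; Put WLK rLeaf (Some rC) rNew; Put LEAF rT1 None rNew;
      Mov rLeaf rNew; Plus rNew rNew rOne; Mov rT rT1].

(** The link of node 1 for the current letter is written at every insertion, so that [climb] has a
    place to stop even if the letter is new. *)
Definition insert : cmd :=
  Sq (Blk [:: Plus rT1 rT rOne; Get rC TXT rT1 None; Put WLK rOne (Some rC) rTwo; Mov rY rLeaf])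
 (Sq climb
 (Sq (Blk [:: Get rK LEN rY None; Minus rE rT1 rK; Get rA TXT rE None;
              Get rZ CHD rQ (Some rA); Mov rB rQ])
 (Sq (Cond (Test true false rZ rZero) split_head (Blk [::]))
     (Blk add_leaf)))).

Definition text (cw : seq nat) (A : nat -> nat -> nat -> nat) : Prop :=
  forall i, 0 < i <= size cw -> A TXT i 0 = nth 0 cw i.-1.

Lemma nth_rev_take (cw : seq nat) P k : k < P <= size cw ->
  nth 0 (rev (take P cw)) k = nth 0 cw (P - k.+1).
Proof.
case/andP=> kP Ps; rewrite nth_rev size_takel //.
by rewrite nth_take //; lia.
Qed.

Lemma nth_prefix (u s : seq nat) k : prefix u s -> k < size u -> nth 0 u k = nth 0 s k.
Proof. by case/prefixP=> r -> ku; rewrite nth_cat ku. Qed.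

(** * Finding and performing a split *)

Section Scan.

Variables (n : nat) (inp : nat -> nat) (cw : seq nat) (ns : seq (seq nat)) (x v : seq nat).
Variables (c kv kb : nat) (V : nat -> nat) (A : nat -> nat -> nat -> nat) (R K : nat).
Hypotheses (sh : tree_shape ns x) (tab : tables cw ns x A) (txt : text cw A).
Hypotheses (scw : size cw = n + n) (nsl : (size ns).+2 <= lim n).
Hypotheses (sx : size x < size cw) (cx : c :: x = rev (take (size x).+1 cw)).
Hypotheses (vN : v \in ns) (kvb : kv < kb) (kbx : kb <= size x) (kbv : kb < size v).
Hypotheses (lkv : level ns x kv) (lkb : level ns x kb).
Hypotheses (E : take kb v = take kb (c :: x)) (ne : nth 0 (c :: x) kb <> nth 0 v kb).
Hypotheses (VT1 : V rT1 = (size x).+1) (VLz : V rLz = size v).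
Hypotheses (VPz : V rPz = A POS (node_id ns v) 0) (VY : V rY = level_id ns x kv).
Hypotheses (VY2 : V rY2 = node_id ns x).
Hypothesis KR : 10 * depth ns x (size x).+1 + R + 1 <= K.

Lemma scan_ok : ok n inp (Loop (Test true false rY2 rY) scan_step) (State V A) K
  (fun st K' => exists V', [/\ st = State V' A, V' rP = level_id ns x kb,
    forall r, r \notin [:: rK; rE; rF; rP; rY2] -> V' r = V r
    & 10 * depth ns x kv + R <= K']).
Proof.
have idl k : level ns x k -> 0 < level_id ns x k < lim n.
  by move=> lk; rewrite level_id_gt0 (leq_trans (level_id_lt lk)).
pose P := A POS (node_id ns v) 0; have VP : V rPz = P := VPz.
have PO : prefix v (rev (take P cw)) := tab_occ tab vN; have Px : P <= size x := tab_pos tab vN.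
have sP : size v <= P.
  by have := size_prefix PO; rewrite size_rev size_take_min => /leq_trans; apply; exact: geq_minl.
have sl : n + n < lim n by rewrite /lim; lia.
(* Nodes are read backwards from position [P] of the text, whose cells are numbered from 1. *)
have vE j : j < size v -> A TXT (P - j) 0 = nth 0 v j.
  move=> jv; rewrite txt; last by lia.
  by rewrite (nth_prefix PO) // nth_rev_take ?subnS //; lia.
have xE j : j <= size x -> A TXT ((size x).+1 - j) 0 = nth 0 (c :: x) j.
  move=> jx; rewrite txt; last by lia.
  by rewrite cx nth_rev_take ?subnS //; lia.
pose I st K' := exists V' j, [/\ st = State V' A, kv <= j <= (size x).+1 /\ level ns x j,
    V' rY2 = level_id ns x j /\ (j < kb -> V' rP = level_id ns x kb),
    forall r, r \notin [:: rK; rE; rF; rP; rY2] -> V' r = V r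
    & 10 * depth ns x j + R + 1 <= K'].
apply: (ok_loop (I := I)).
- by move=> st K' [V' [j [_ _ _ _]]]; lia.
- move=> st K' [V' [j [-> [/andP[kvj jx] lj] [y2 pE] fr cr]]] /=.
  rewrite y2 fr // VY => nej.
  have kvj' : kv < j by rewrite ltn_neqAle kvj andbT; apply: contra nej => /eqP->.
  have [|j' [jj' lj' pj] nj'] := level_par sh tab lj; first by rewrite jx andbT; lia.
  have dj := depth_lt jj' lj.
  have kvj2 : kv <= j'.
    by rewrite leqNgt; apply/negP => j'kv; have := nj' kv; rewrite j'kv kvj' lkv => /(_ isT).
  apply: ok_blk_seq; first by rewrite /=; lia.
  rewrite /= /upd /= y2 idl // (level_len tab lj jx); split=> //.
  set V1 := fun a' => _; rewrite -/V1.
  have V1K : V1 rK = j by [].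
  have V1Y2 : V1 rY2 = level_id ns x j by rewrite -y2.
  have V1P : V1 rP = V' rP by [].
  have fr1 r : r \notin [:: rK; rE; rF; rP; rY2] -> V1 r = V r.
    by move=> rn; rewrite -fr // /V1; case: eqP rn => // ->.
  clearbody V1.
  pose M st K' := exists V2, [/\ st = State V2 A, V2 rY2 = level_id ns x j,
    j' < kb -> V2 rP = level_id ns x kb,
    forall r, r \notin [:: rK; rE; rF; rP; rY2] -> V2 r = V r
    & 10 * depth ns x j' + R + 2 <= K'].
  have pj' : j <> kb -> j' < kb -> V1 rP = level_id ns x kb.
    move=> jk j'k; rewrite V1P; apply: pE; rewrite ltn_neqAle (introN eqP jk) leqNgt.
    by apply/negP => kj; have := nj' kb; rewrite j'k kj lkb => /(_ isT).
  apply: ok_seq; apply: (@ok_mono _ _ _ _ _ M).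
    move=> s1 K1 [V2 [-> y22 p2 fr2 cr2]].
    apply: ok_blk; first by rewrite /=; lia.
    rewrite /= /upd /= y22 pj idl //; split=> //.
    set V3 := fun a' => _; exists V3, j'; split=> //.
    - by rewrite kvj2 ltnW // (leq_trans jj').
    - move=> r rn; rewrite -fr2 // /V3; by case: eqP rn => // ->.
    - by rewrite /=; lia.
  apply: ok_cond; first by rewrite /=; lia.
  - rewrite /= V1K fr1 // VLz => jv.
    apply: ok_blk_seq; first by rewrite /=; lia.
    have jx2 : j <= size x by rewrite (leq_trans (ltnW jv)) // (node_size sh vN).
    rewrite /= /upd /= V1K !fr1 // VP VT1 vE // xE //.
    do 4!(split; first by lia).
    set V2 := fun a' => _; rewrite -/V2.
    have V2E : V2 rE = nth 0 v j by [].
    have V2F : V2 rF = nth 0 (c :: x) j by [].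
    have V2Y2 : V2 rY2 = level_id ns x j by rewrite -V1Y2.
    have V2P : V2 rP = V1 rP by [].
    have fr2 r : r \notin [:: rK; rE; rF; rP; rY2] -> V2 r = V r.
      by move=> rn; rewrite -fr1 // /V2; do 4?(case: eqP rn => [-> //|_ rn]).
    clearbody V2.
    apply: ok_cond; first by rewrite /=; lia.
    + rewrite /= V2E V2F => nej2; apply: ok_blk; first by rewrite /=; lia.
      rewrite /= /upd /=; split=> //.
      set V3 := fun a' => _; exists V3; split=> //.
      * move=> j'k; rewrite /V3 /= V2Y2.
        suff -> : j = kb by [].
        case: (ltngtP j kb) => // jk.
          case/negP: nej2; have := congr1 (nth 0 ^~ j) E.
          by rewrite !nth_take // => ->.
        by have := nj' kb; rewrite j'k jk lkb => /(_ isT).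
      * by move=> r rn; rewrite -fr2 // /V3; case: eqP rn => // ->.
      * by rewrite /=; lia.
    + rewrite /= V2E V2F => ej; apply: ok_blk => //=.
      exists V2; split=> //; last by lia.
      rewrite V2P; apply: pj' => jk; rewrite jk in ej.
      by case: ne; move/negPn/eqP: ej.
  - rewrite /= V1K fr1 // VLz => jv.
    apply: ok_blk => //=; exists V1; split=> //; last by lia.
    by apply: pj' => jk; rewrite jk kbv in jv.
- move=> st K' [V' [j [-> [/andP[kvj jx] lj] [y2 pE] fr cr]]] /=.
  rewrite y2 fr // VY => /negPn/eqP ej.
  have e : j = kv.
    rewrite -(level_len tab lj jx) ej (level_len tab lkv) //; lia.
  exists V'; split=> //; first by apply: pE; rewrite e.
  by move: cr; rewrite e; lia.
- exists V, (size x).+1; split=> //.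
  + by split; rewrite /level /= ?take_size ?(shape_text sh) ?orbT //; lia.
  + by split=> [|j]; rewrite /= ?take_size //; lia.
Qed.

End Scan.

Definition consts (n : nat) (V : nat -> nat) : Prop :=
  [/\ V rN = n, V rZero = 0, V rOne = 1, V rTwo = 2 & V rNN = n + n].

Definition pref (cw : seq nat) (t : nat) : seq nat := rev (take t cw).

Lemma size_pref cw t : t <= size cw -> size (pref cw t) = t.
Proof. by move=> tc; rewrite size_rev size_takel. Qed.

Lemma prefS cw t : t < size cw -> pref cw t.+1 = nth 0 cw t :: pref cw t.
Proof. by move=> tc; rewrite /pref (take_nth 0) // rev_rcons. Qed.

Lemma pref_drop cw i t : i <= t <= size cw -> pref cw i = drop (t - i) (pref cw t).
Proof.
case/andP=> it tc; rewrite /pref drop_rev size_takel // subKn // take_takel //.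
Qed.

(** Each letter adds at most a split node and a leaf to the initial root, whence the bound on
    [size ns]. *)
Record built (n : nat) (cw : seq nat) (t : nat) (ns : seq (seq nat))
    (V : nat -> nat) (A : nat -> nat -> nat -> nat) : Prop := Built {
  bt_shape : tree_shape ns (pref cw t);
  bt_tab : tables cw ns (pref cw t) A;
  bt_size : size ns <= t.*2.+1;
  bt_consts : consts n V;
  bt_t : V rT = t;
  bt_leaf : V rLeaf = node_id ns (pref cw t);
  bt_new : V rNew = (size ns).+2;
  bt_text : text cw A;
  bt_leaves : forall i, 0 < i <= t -> A LEAF i 0 = node_id ns (pref cw i);
  bt_min : forall i j, A MIN i j = 0
}.

Lemma pref_in ns cw i t : tree_shape ns (pref cw t) -> i <= t <= size cw -> pref cw i \in ns.
Proof. by move=> sh it; rewrite (pref_drop it) (drop_in sh). Qed.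

Section SplitHead.

Variables (n : nat) (inp : nat -> nat) (cw : seq nat) (ns : seq (seq nat)) (x v : seq nat).
Variables (c kv : nat) (V : nat -> nat) (A : nat -> nat -> nat -> nat) (R K : nat).
Let X := c :: x.
Let q := take kv X.
Hypotheses (sh : tree_shape ns x) (tab : tables cw ns x A) (txt : text cw A).
Hypotheses (scw : size cw = n + n) (nsl : (size ns).+4 <= lim n).
Hypothesis (cwn : forall i, nth 0 cw i < n.+2).
Hypotheses (sx : size x < size cw) (cx : X = rev (take (size x).+1 cw)).
Hypotheses (c1 : A WLK 1 c = 2) (kvN : q \in ns) (kvx : kv <= (size x).+1).
Hypothesis lkv : level ns x kv.
Hypothesis above : forall j, kv < j <= (size x).+1 -> take j X \notin ns.
Hypotheses (qv : child ns q v) (vq : nth 0 v kv = nth 0 X kv).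
Hypotheses (V1 : consts n V) (VT1 : V rT1 = (size x).+1) (VC : V rC = c).
Hypotheses (VQ : V rQ = node_id ns q) (VA : V rA = nth 0 X kv) (VZ : V rZ = node_id ns v).
Hypotheses (VY : V rY = level_id ns x kv) (VL : V rLeaf = node_id ns x).
Hypotheses (VN : V rNew = (size ns).+2).
Hypothesis KR : 10 * depth ns x (size x).+1 + R + 21 <= K.

Lemma split_head_ok : ok n inp split_head (State V A) K (fun st K' => exists V' A' b k,
  [/\ st = State V' A' /\ [/\ tree_shape (rcons ns b) x, tables cw (rcons ns b) x A' & A' WLK 1 c = 2],
      [/\ k <= size x, b = take k X & ~~ infix (take k.+1 X) x],
      [/\ V' rB = node_id (rcons ns b) b, V' rNew = (size ns).+3 & V' rA = nth 0 X k],
      forall r, r \notin [:: rK; rE; rF; rP; rY2; rB; rNew; rA; rLz; rPz] -> V' r = V r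
    & (forall a, a \notin [:: LEN; POS; PAR; WLK; CHD] -> A' a = A a)
      /\ 10 * depth ns x kv + R <= K']).
Proof.
have kx : kv <= size x := head_le sh kvN kvx.
have [kb [/andP[kvb kbv] [kbx lkb] E ne kI]] := head_split sh kvN kvx above qv vq.
have [V0 VZ0 VO VTw VNN] := V1.
have vN : v \in ns by case: qv.
have idl u : u \in ns -> 0 < node_id ns u < lim n.
  move/node_id_lt => l; apply/andP; split=> //; apply: leq_trans l _.
  exact: (leq_trans (leqW (leqnSn _)) nsl).
have vx : size v <= size x := node_size sh vN.
have xl : (size x).+2 < lim n by rewrite /lim; lia.
pose P := A POS (node_id ns v) 0.
have PO : prefix v (rev (take P cw)) := tab_occ tab vN.
have Px : P <= size x := tab_pos tab vN.
have sP : size v <= P.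
  by have := size_prefix PO; rewrite size_rev size_take_min => /leq_trans; apply; exact: geq_minl.
apply: ok_blk_seq; first by rewrite /=; lia.
rewrite /= /upd /= VZ VO (tab_len tab vN) -/P subSS subn0 idl //.
do 4!(split; first by rewrite /=; lia).
set V2 := fun a' => _; rewrite -/V2.
have V2L : V2 rLz = size v by [].
have V2P : V2 rPz = P by [].
have V2Y : V2 rY2 = node_id ns x by rewrite -VL.
have fr2 r : r \notin [:: rLz; rPz; rY2] -> V2 r = V r.
  by move=> rn; rewrite /V2; do 4?(case: eqP rn => [-> //|_ rn]).
clearbody V2.
apply: ok_seq; apply: (ok_mono _ (@scan_ok n inp cw ns x v c kv kb V2 A (R + 16) _ sh tab txt
  scw _ sx cx vN kvb kbx kbv lkv lkb E ne _ V2L V2P _ V2Y _)).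
- move=> s K' [V3 [-> V3P fr3 cr3]].
  have fr r : r \notin [:: rK; rE; rF; rP; rY2; rLz; rPz] -> V3 r = V r.
    move=> rn; rewrite fr3; first rewrite fr2 //;
    by apply: contra rn; rewrite !inE; do ?(case/orP; [move=> -> //|]); rewrite ?orbT // => ->; rewrite ?orbT.
  have V3z : V3 rPz = P by rewrite fr3.
  have kb0 : 0 < kb by lia.
  pose p := take kb.-1 x.
  have pN : p \in ns by move: lkb; rewrite /level => /orP[/eqP e|//]; rewrite e in kb0.
  have pid : V3 rP = node_id ns p by rewrite V3P /level_id /p; case: (kb) kb0.
  have plen : A LEN (node_id ns p) 0 = kb.
    by rewrite (tab_len tab pN) /p size_takel ?prednK // (leq_trans (leq_pred _)).
  have zk : take kb v = c :: p by rewrite E /p; case: (kb) kb0.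
  have vE : A TXT (P - kb) 0 = nth 0 v kb.
    rewrite txt; last by lia.
    by rewrite (nth_prefix PO) // nth_rev_take ?subnS //; lia.
  have xE : A TXT ((size x).+1 - kb) 0 = nth 0 X kb.
    rewrite txt; last by lia.
    by rewrite cx nth_rev_take ?subnS //; lia.
  have lv : nth 0 v kb < n.+2 by rewrite -vE txt; [exact: cwn | lia].
  have lx : nth 0 X kb < n.+2 by rewrite -xE txt; [exact: cwn | lia].
  have lkx : nth 0 X kv < n.+2.
    by rewrite cx nth_rev_take; [exact: cwn | lia].
  have lc : c < n.+2.
    by rewrite (_ : c = nth 0 X 0) // cx nth_rev_take; [exact: cwn | lia].
  apply: ok_blk; first by rewrite /=; lia.
  have f1 : V3 rOne = 1 by rewrite fr.
  have fN : V3 rNew = (size ns).+2 by rewrite fr.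
  have fQ : V3 rQ = node_id ns q by rewrite fr.
  have fZ : V3 rZ = node_id ns v by rewrite fr.
  have fA : V3 rA = nth 0 X kv by rewrite fr.
  have fC : V3 rC = c by rewrite fr.
  have fT : V3 rT1 = (size x).+1 by rewrite fr.
  rewrite /= /upd /= V3z pid plen f1 fN fQ fZ fA fC fT /upd3 /= vE xE.
  have ml : (size ns).+3 < lim n by [].
  have [_ lp] := andP (idl p pN); have [_ lq] := andP (idl q kvN).
  have [_ lz] := andP (idl v vN).
  do 15!(split; [by first [done | rewrite ?addn1; lia] |]).
  set V4 := fun a' : nat => _; set A4 := fun a' i' j' : nat => _.
  have sq : size q = kv by rewrite size_takel //= ltnW.
  have kqz : size q < kb < size v by rewrite sq kvb.
  exists V4, A4, (take kb v), kb.
  have A4E : A4 = split_arr ns q p v c kb A.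
    by rewrite /A4 /split_arr /upd3 addn1 sq vq.
  split.
  + split=> //; rewrite A4E; split.
    * exact: (split_shape sh qv zk pN).
    * exact: (split_tables sh tab qv kqz zk pN).
    * by rewrite /split_arr /upd3 /= andbF.
  + by [].
  + split; rewrite /V4 /= ?addn1 // node_id_last //.
    exact: (split_new qv kqz).
  + move=> r rn; rewrite /V4; do 14?(case: eqP rn => [-> //|_ rn]).
    rewrite fr //; apply: contra rn; rewrite !inE.
    by do ?(case/orP; [move=> -> //|]); rewrite ?orbT // => ->; rewrite ?orbT.
  + split; last by rewrite /=; lia.
    by move=> a an; rewrite /A4 /upd3; do 5?(case: eqP an => [-> //|_ an]).
- exact: (leq_trans (leqW (leqnSn _)) nsl).
- by rewrite fr2.
- by rewrite fr2.
- by rewrite /=; lia.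
Qed.

End SplitHead.

Definition potential (ns : seq (seq nat)) (s : seq nat) : nat := depth ns s (size s).+1.

(** The three units are the leaf, a possible split node and the loss in [depth_cons]; no old node is
    a prefix of the new text longer than [k]. *)
Lemma potential_insert ns ns1 x c k :
  tree_shape ns x -> (ns1 = ns \/ exists b, ns1 = rcons ns b) ->
  k <= size x -> (forall j, k < j <= (size x).+1 -> take j (c :: x) \notin ns) ->
  potential (rcons ns1 (c :: x)) (c :: x) <= depth ns x k + 3.
Proof.
move=> sh Hns1 kx above; rewrite /potential.
apply: leq_trans (depth_rcons _ _ (leqnn _)) _.
have H1 : depth ns1 (c :: x) (size (c :: x)).+1 <= (depth ns (c :: x) (size (c :: x)).+1).+1.
  by case: Hns1 => [->//|[b ->]]; exact: depth_rcons.
have H2 : depth ns (c :: x) (size (c :: x)).+1 <= depth ns (c :: x) k.+1.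
  by apply: depth_top => j /andP[kj jx]; apply: above; rewrite kj.
have H3 := depth_cons c x k sh.
by lia.
Qed.

(** [climb] and the scan walk up the same nodes, from the leaf to level [k], at 3 and 10 credits
    each: this is the factor 13. The constant 95 also covers the rise of the potential by at most
    three units. *)
Lemma insert_ok n inp cw t ns V A R K :
  built n cw t ns V A -> t < size cw -> size cw = n + n ->
  (forall i, nth 0 cw i < n.+2) ->
  13 * potential ns (pref cw t) + 95 + R <= K ->
  ok n inp insert (State V A) K (fun st K' => exists V' A' ns',
    [/\ st = State V' A', built n cw t.+1 ns' V' A' &
        13 * potential ns' (pref cw t.+1) + R <= K']).
Proof.
case=> sh tab nss vc vt vl vn txt lf mn tcw scw cwn KR.
have [v0 vz v1 v2 vnn] := vc.
have sx := size_pref (ltnW tcw).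
move: sh tab vl KR; set x := pref cw t in sx *; move=> sh tab vl KR.
set c := nth 0 cw t; have cx : pref cw t.+1 = c :: x := prefS tcw.
have cxr : c :: x = rev (take (size x).+1 cw) by rewrite -cx sx.
have xN := shape_text sh.
have nsl : (size ns) + 5 <= lim n by move: nss tcw scw; rewrite /lim -addnn; lia.
have nsl4 : (size ns).+4 <= lim n by lia.
have nsl2 : (size ns).+2 <= lim n by lia.
have tl : t.+2 < lim n by rewrite /lim; lia.
have cn : c < n.+2 by exact: cwn.
apply: ok_blk_seq; first by rewrite /=; lia.
rewrite /= /upd /= vt v1 addn1 txt ?tcw // -/c v2.
do 4!(split; first by rewrite /=; lia).
set V1 := fun a' : nat => _; set A1 := upd3 _ _ _ _ _.
have A1E a i j : A1 a i j = if [&& a == WLK, j == c & i == 1] then 2 else A a i j by [].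
(* In row 1 the tables are constrained only at letters of [x], where the value written is the
   required one. *)
have tab1 : tables cw ns x A1.
  case: tab => t0 t1 t2 t3 t4 t5 t6 t7 t8 t9 t10; split=> [|u uN|u uN|u uN||u v cuv|d dx|u d uN|u v cuv|u a uN ni|i a hi]; rewrite !A1E /=.
  - exact: t0.
  - exact: t1.
  - exact: t2.
  - exact: t3.
  - exact: t4.
  - exact: t5.
  - by case: ifP => // _; apply: t6.
  - by rewrite andbF; apply: t7.
  - exact: t8.
  - exact: t9.
  - case: ifP => [/andP[_ /eqP e]|_]; last exact: t10.
    by rewrite e in hi.
have c1 : A1 WLK 1 c = 2 by rewrite A1E !eqxx.
have txt1 : text cw A1 by move=> i hi; rewrite A1E /= txt.
have V1C : V1 rC = c by [].
have V1T : V1 rT1 = t.+1 by [].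
have V1Y : V1 rY = level_id ns x t.+1 by rewrite /level_id -sx take_size.
have fr1 r : r \notin [:: rT1; rC; rY] -> V1 r = V r.
  by move=> rn; rewrite /V1; do 3?(case: eqP rn => [-> //|_ rn]).
clearbody V1; clearbody A1.
apply: ok_seq; apply: (ok_mono _ (@climb_ok n inp cw ns x x c V1 A1 t.+1 
  (10 * potential ns x + 80 + R) _ sh tab1 nsl2 cn c1 _ V1C V1Y _ _ _)).
- move=> s K1 [V2 [k [[-> kt] [V2Y lk] [kN V2Q] above [fr2 cr2]]]].
  have kx : k <= size x by apply: (head_le sh kN); rewrite sx.
  set q := take k (c :: x) in kN V2Q.
  have F r : r \notin [:: rY; rQ; rT1; rC] -> V2 r = V r.
    by rewrite !inE !negb_or => /and4P[a1 a2 a3 a4]; rewrite fr2 // fr1 // !inE !negb_or a1 a3 a4.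
  have V2T : V2 rT1 = t.+1 by rewrite fr2.
  have V2C : V2 rC = c by rewrite fr2.
  have idl u : u \in ns -> 0 < node_id ns u < lim n.
    move/node_id_lt => l; apply/andP; split=> //; exact: leq_trans l _.
  have lidl : 0 < level_id ns x k < lim n.
    by rewrite level_id_gt0 (leq_trans (level_id_lt lk)).
  have xE j : j <= size x -> A1 TXT (t.+1 - j) 0 = nth 0 (c :: x) j.
    move=> jx; rewrite txt1; last by lia.
    by rewrite cxr nth_rev_take sx ?subnS //; lia.
  have lX j : j <= size x -> nth 0 (c :: x) j < n.+2.
    by move=> jx; rewrite -xE // txt1; [exact: cwn | lia].
  apply: ok_blk_seq; first by rewrite /=; lia.
  rewrite /= /upd /= V2Y (level_len tab1 lk) // ?sx // V2T xE // V2Q !idl // lX //.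
  have tk : k <= t.+1 < lim n by lia.
  do 5!(split; first by rewrite /=; lia).
  set V3 := fun a' : nat => _.
  have V3K : V3 rK = k by [].
  have V3A : V3 rA = nth 0 (c :: x) k by [].
  have V3Z : V3 rZ = A1 CHD (node_id ns q) (nth 0 (c :: x) k) by [].
  have V3B : V3 rB = node_id ns q by rewrite -V2Q.
  have V3Q : V3 rQ = node_id ns q by rewrite -V2Q.
  have V3Y : V3 rY = level_id ns x k by rewrite -V2Y.
  have V3T : V3 rT1 = t.+1 by rewrite -V2T.
  have V3C : V3 rC = c by rewrite -V2C.
  have F3 r : r \notin [:: rY; rQ; rT1; rC; rK; rA; rZ; rB; rE] -> V3 r = V r.
    rewrite !inE !negb_or => /and5P[a1 a2 a3 a4 /and5P[a5 a6 a7 a8 a9]].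
    rewrite -F ?inE ?negb_or ?a1 ?a2 ?a3 //.
    by rewrite /V3 (negbTE a5) (negbTE a6) (negbTE a7) (negbTE a8) (negbTE a9).
  clearbody V3.
  (* The situation before the leaf is added, whether or not an edge was split: [take kb (c :: x)] is
     a node and will be the parent of the leaf. *)
  pose M st K' := exists V4 A4 ns1 kb,
    [/\ st = State V4 A4 /\ (ns1 = ns \/ exists b, ns1 = rcons ns b),
        [/\ tree_shape ns1 x, tables cw ns1 x A4 & A4 WLK 1 c = 2],
        [/\ kb <= size x, take kb (c :: x) \in ns1 & ~~ infix (take kb.+1 (c :: x)) x],
        [/\ V4 rB = node_id ns1 (take kb (c :: x)), V4 rNew = (size ns1).+2,
            V4 rA = nth 0 (c :: x) kb, V4 rT1 = t.+1 & V4 rC = c]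
      & [/\ forall r, r \in [:: rN; rZero; rOne; rTwo; rNN; rLeaf] -> V4 r = V r,
            forall a, a \notin [:: LEN; POS; PAR; WLK; CHD] -> A4 a = A1 a
          & 13 * depth ns x k + 50 + R <= K']].
  apply: ok_seq; apply: (@ok_mono _ _ _ _ _ M).
    move=> s2 K2 [V4 [A4 [ns1 [kb [[-> ns1E] [sh1 tab4 c4] [kbx bN kI]
      [V4B V4N V4A V4T V4C] [F4 fA4 cr4]]]]]].
    have mem1 u : u \in ns -> u \in ns1.
      by case: ns1E => [->|[b ->]] // uN; rewrite mem_rcons inE uN orbT.
    have id1 u : u \in ns -> node_id ns1 u = node_id ns u.
      by case: ns1E => [->|[b ->]] // uN; rewrite node_id_rcons.
    have sz1 : size ns1 <= (size ns).+1.
      by case: ns1E => [->|[b ->]] //; rewrite size_rcons.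
    have idl1 u : u \in ns1 -> node_id ns1 u < lim n.
      move/node_id_lt => l; apply: leq_trans l _.
      by apply: leq_trans nsl4; rewrite !ltnS leqW.
    have nl1 : (size ns1).+3 < lim n by apply: leq_trans nsl; rewrite !addnS addn0 !ltnS.
    have V41 : V4 rOne = 1 by rewrite F4.
    have V4L : V4 rLeaf = node_id ns1 x by rewrite F4 // vl id1.
    apply: ok_blk; first by rewrite /=; lia.
    rewrite /= /upd /= V4B V4N V4A V4T V4C V41 V4L.
    have lb := idl1 _ bN; have lx1 := idl1 _ (mem1 _ xN).
    have lX1 := lX _ kbx.
    do 10!(split; [by first [done | rewrite ?addn1; lia] |]).
    set V5 := fun a' : nat => _; set A5 := upd3 _ _ _ _ _.
    have A5E : A5 = leaf_arr ns1 x c kb A4 by rewrite /leaf_arr sx /A5 addn1.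
    exists V5, A5, (rcons ns1 (c :: x)); split=> //; last first.
      rewrite cx; have := potential_insert sh ns1E kx; rewrite sx => /(_ c above).
      by rewrite /=; lia.
    split; rewrite ?cx.
    + by apply: (leaf_shape sh1 kbx).
    + by rewrite A5E; apply: (leaf_tables sh1 tab4).
    + by rewrite size_rcons -!addnn; move: sz1 nss; rewrite -addnn; lia.
    + by split; rewrite /V5 /= F4.
    + by rewrite /V5 /=.
    + by rewrite /V5 /= node_id_last // (leaf_new c sh1).
    + by rewrite /V5 /= size_rcons addn1.
    + by move=> i hi; rewrite A5E /leaf_arr /upd3 /= fA4 // txt1.
    + move=> i /andP[i0 it]; rewrite A5E /leaf_arr /upd3 /= sx.
      case: eqP => [->|ni]; first by rewrite cx node_id_last // (leaf_new c sh1).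
      have it' : i <= t by lia.
      have iN : pref cw i \in ns by apply: (pref_in sh); rewrite it' ltnW.
      rewrite fA4 // A1E /= lf ?i0 // node_id_rcons ?mem1 // id1 //.
    + by move=> i j; rewrite A5E /leaf_arr /upd3 /= fA4 // A1E /= mn.
  apply: ok_cond; first by rewrite /=; lia.
  - rewrite /= V3Z F3 // vz => zn0.
    have [v qv vk] : exists2 v, child ns q v & nth 0 v (size q) = nth 0 (c :: x) k.
      apply: (child_ex sh) => //; apply/negPn/negP => ni; case/eqP: zn0.
      by rewrite (tab_chd0 tab1).
    have sq : size q = k by rewrite size_takel //= leqW.
    have zE : A1 CHD (node_id ns q) (nth 0 (c :: x) k) = node_id ns v.
      by rewrite -vk (tab_chd tab1 qv).
    apply: (ok_mono _ (@split_head_ok n inp cw ns x v c k V3 A1 (3 * depth ns x k + 50 + R) _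
      sh tab1 txt1 scw nsl4 cwn _ cxr c1 kN _ lk _ qv _ _ _ V3C V3Q V3A _ V3Y _ _ _)).
    + move=> s2 K2 [V4 [A4 [b [kb [[-> [sh4 tab4 c4]] [kbx bE kI] [V4B V4N V4A] F4 [fA4 cr4]]]]]].
      exists V4, A4, (rcons ns b), kb; split=> //.
      * by split=> //; right; exists b.
      * by split=> //; rewrite -bE mem_rcons inE eqxx.
      * by split=> //; rewrite -?bE // ?size_rcons // F4.
      * split=> //; last by lia.
        move=> r rn; rewrite F4; first rewrite F3 //.
          by move: rn; rewrite !inE => /or4P[|||/or3P[||]] /eqP->.
        by move: rn; rewrite !inE => /or4P[|||/or3P[||]] /eqP->.
    + by rewrite sx.
    + by rewrite leqW.
    + by rewrite sx.
    + by rewrite -vk sq.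
    + by split; rewrite F3.
    + by rewrite V3T sx.
    + by rewrite V3Z.
    + by rewrite F3.
    + by rewrite F3.
    + by move: cr2; rewrite /potential /=; lia.
  - rewrite /= V3Z F3 // vz => /negPn/eqP z0.
    apply: ok_blk => //=; exists V3, A1, ns, k; split=> //.
    + by split=> //; left.
    + split=> //; rewrite (take_nth 0) /=; last by rewrite ltnS.
      apply/negP => ix; have [v qv vk] := child_ex sh kN ix.
      have sq : size q = k by rewrite size_takel //= leqW.
      by move: z0; rewrite -vk (tab_chd tab1 qv).
    + by split=> //; rewrite F3.
    + split=> //; last by have := depth_le ns x (leqW kx); move: cr2; rewrite /potential /=; lia.
      by move=> r rn; rewrite F3 //; move: rn; rewrite !inE => /or4P[|||/or3P[||]] /eqP->.
- by rewrite fr1.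
- by rewrite /level /= -sx take_size xN.
- by rewrite sx.
- by rewrite /potential sx /=; move: KR; rewrite /potential sx /=; lia.
Qed.

(** * Gapped factors as prefixes of left-arm texts *)

Definition arm_text (K : gapped_kind) (w : seq nat) (e : nat) : seq nat :=
  if K is Repeat then rev (take e.+1 w) else drop e w.

(** [m] is a position counted from 1, as returned by [first_occ]: the last letter of the left arm
    for repeats, its first letter for palindromes. *)
Definition arm_end (K : gapped_kind) (m l : nat) : nat :=
  if K is Repeat then m else m + l.-1.

(** Positions are shifted by one so that 0, the content of a blank cell, means that there is
    none. *)
Definition first_occ (K : gapped_kind) (w : seq nat) (e : nat) (u : seq nat) : nat :=
  let P e' := prefix u (arm_text K w e') in
  if has P (iota 0 e) then (find P (iota 0 e)).+1 else 0.

Definition feasible K w g i l := exists p m, admissible K w g p l m /\ p + l + m = i.+1.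

Lemma first_occS K w e u : first_occ K w e.+1 u =
  if first_occ K w e u == 0 then if prefix u (arm_text K w e) then e.+1 else 0
  else first_occ K w e u.
Proof.
rewrite /first_occ -addn1 iotaD has_cat find_cat /= add0n.
case h: (has _ (iota 0 e)); case pr: (prefix u _) => //=.
by rewrite size_iota addn0 addn1.
Qed.

Lemma first_occ0 K w e u : first_occ K w e u = 0 ->
  forall e', e' < e -> ~~ prefix u (arm_text K w e').
Proof.
rewrite /first_occ; case: ifP => // /negbT/hasPn H _ e' le.
by apply: H; rewrite mem_iota.
Qed.

Lemma first_occP K w e u m : first_occ K w e u = m.+1 ->
  [/\ m < e, prefix u (arm_text K w m) &
      forall e', e' < e -> prefix u (arm_text K w e') -> m <= e'].
Proof.
rewrite /first_occ; case: ifP => // H [<-].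
have lt : find (fun e' => prefix u (arm_text K w e')) (iota 0 e) < e.
  by rewrite -[X in _ < X](size_iota 0 e) -has_find.
split=> //; first by have := nth_find 0 H; rewrite nth_iota.
move=> e' le' pe'; rewrite leqNgt; apply/negP => l.
by have := before_find 0 l; rewrite nth_iota // pe'.
Qed.

Lemma eq_first_occ K w e u v :
  (forall e', e' < e -> prefix u (arm_text K w e') = prefix v (arm_text K w e')) ->
  first_occ K w e u = first_occ K w e v.
Proof.
move=> H; elim: e H => [|e IH] H //.
by rewrite !first_occS IH ?H // => e' l; rewrite H // leqW.
Qed.

Lemma gapped_factorE K w p l m : gapped_factor K w p l m <->
  [/\ 0 < p, p.-1 + l + m + l <= size w &
      take l (drop p.-1 w) = left_arm K (take l (drop (p.-1 + l + m) w))].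
Proof.
have sla u : size (left_arm K u) = size u by case: K => //=; rewrite size_rev.
split=> [[x [u [v [y [-> <- <- <-]]]]]|[p0 sw e]].
  rewrite /= drop_size_cat // !size_cat sla; split=> //; first by lia.
  rewrite -{1}(sla u) take_size_cat //; congr left_arm.
  rewrite catA catA drop_size_cat ?take_size_cat //.
  by rewrite !size_cat sla.
set u := take l (drop (p.-1 + l + m) w) in e.
exists (take p.-1 w), u, (take m (drop (p.-1 + l) w)), (drop (p.-1 + l + m + l) w).
split.
- rewrite -e -{1}[w](cat_take_drop p.-1); congr cat.
  rewrite -{1}[drop p.-1 w](cat_take_drop l); congr cat.
  rewrite drop_drop [l + p.-1]addnC -{1}[drop (p.-1 + l) w](cat_take_drop m); congr cat.
  rewrite drop_drop [m + _]addnC -{1}[drop (p.-1 + l + m) w](cat_take_drop l); congr cat.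
  by rewrite drop_drop [l + _]addnC.
- by rewrite size_takel; lia.
- by rewrite /u size_takel // size_drop; lia.
- by rewrite size_takel // size_drop; lia.
Qed.

(** With [u] read backwards, the left arms of both kinds are prefixes of
    [arm_text]: of a reversed prefix of [w] for repeats, of a suffix of [w] for
    palindromes. *)
Lemma admissibleE K w g p l m : 0 < l -> admissible K w g p l m <->
  exists2 e, e < size w /\ p + l = (arm_end K e.+1 l).+1 &
    [/\ p + l + m + l <= (size w).+1, l <= arm_end K e.+1 l,
        prefix (rev (take l (drop (p + l + m).-1 w))) (arm_text K w e) & g (p + l + m) <= m].
Proof.
move=> l0.
have main : 0 < p -> p + l + m + l <= (size w).+1 ->
    (take l (drop p.-1 w) == left_arm K (take l (drop (p.-1 + l + m) w))) =
    prefix (rev (take l (drop (p + l + m).-1 w)))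
      (arm_text K w (if K is Repeat then (p + l).-2 else p.-1)).
  move=> p0 sw; have -> : (p + l + m).-1 = p.-1 + l + m by lia.
  have h : l + p.-1 <= size w by lia.
  set u := take l (drop (p.-1 + l + m) w).
  have su : size u = l by rewrite size_takel // size_drop; lia.
  case: K => /=; first by rewrite prefixE size_rev su.
  rewrite prefix_rev suffixE su (_ : (p + l).-2.+1 = l + p.-1); last by lia.
  rewrite size_takel //.
  by rewrite -addnBAC // subnn add0n take_drop.
split=> [[/gapped_factorE[p0 sw /eqP e] pl gm]|[e [ew pe] [sw le pr gm]]].
  have sw' : p + l + m + l <= (size w).+1 by lia.
  exists (if K is Repeat then (p + l).-2 else p.-1).
    by case: K {main e} => /=; lia.
  by split=> //; [case: K {main e} => /=; lia | rewrite -main].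
have p0 : 0 < p by lia.
split=> //; last by lia.
apply/gapped_factorE; split=> //; first by lia.
apply/eqP; rewrite main //; move: pr; congr (prefix _ (arm_text K w _)).
by case: K pe {main le} => /=; lia.
Qed.

(** Dropping the last letter of [u] keeps the start of the right arm. In a palindrome the left arm
    then loses its first letter and the gap is unchanged; in a repeat it loses its last letter and
    the gap grows by one. *)
Lemma feasible_pred K w g i l : feasible K w g i l.+1 -> feasible K w g i l.
Proof.
move=> [p [m [[/gapped_factorE [p0 sw e] pl gm] E]]].
have s1 : l <= size (drop p.-1 w) by rewrite size_drop; lia.
case: K e => /= e.
  exists p.+1, m; split; last by lia.
  split; [|lia|by rewrite addSnnS].
  apply/gapped_factorE; split=> //=; first by lia.
  have -> : p + l + m = p.-1 + l.+1 + m by lia.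
  have := congr1 behead e.
  have -> : behead (take l.+1 (drop p.-1 w)) = take l (drop p w).
    by rewrite -drop1 -[l.+1]addn1 -take_drop drop_drop add1n prednK.
  move=> ->; set u := drop _ w.
  have su : l < size u by rewrite size_drop; lia.
  by rewrite (take_nth 0) // rev_rcons.
exists p, m.+1; split; last by lia.
split; [|lia|by rewrite (_ : p + l + m.+1 = p + l.+1 + m) ?leqW //; lia].
apply/gapped_factorE; split=> //=; first by lia.
have -> : p.-1 + l + m.+1 = p.-1 + l.+1 + m by lia.
exact: take_min (leqnSn l) e.
Qed.

Lemma feasible_le K w g i l l' : l' <= l -> feasible K w g i l -> feasible K w g i l'.
Proof.
elim: l => [|l IH]; first by rewrite leqn0 => /eqP->.
by rewrite leq_eqVlt => /orP[/eqP->|/IH H /feasible_pred].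
Qed.

Lemma arm_end_ge K w e l u : 0 < l -> size u = l -> prefix u (arm_text K w e) ->
  l <= arm_end K e.+1 l.
Proof.
case: K => /= l0 su pr; first by lia.
have := size_prefix pr; rewrite su size_rev size_take_min => le.
by apply: leq_trans le _; exact: geq_minl.
Qed.

Lemma arm_end_mono K m m' l : m <= m' -> arm_end K m l <= arm_end K m' l.
Proof. by case: K => //= le; rewrite leq_add2r. Qed.

Section FirstOcc.

Variables (K : gapped_kind) (w : seq nat) (g : nat -> nat) (i l : nat).
Hypotheses (l0 : 0 < l) (il : i + l <= size w).

Let m := first_occ K w (size w) (rev (take l (drop i w))).

(** The inequality also excludes an earliest left arm that overlaps the right one. *)
Lemma first_occ_admissible : 0 < m -> arm_end K m l + g i.+1 <= i ->
  l <= arm_end K m l /\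
  admissible K w g ((arm_end K m l).+1 - l) l (i - arm_end K m l).
Proof.
case em: m => [|e] // _ ge.
have [es pr _] := first_occP em.
have su : size (rev (take l (drop i w))) = l.
  by rewrite size_rev size_takel // size_drop; lia.
have le := arm_end_ge l0 su pr; split=> //.
have E : (arm_end K e.+1 l).+1 - l + l + (i - arm_end K e.+1 l) = i.+1 by lia.
apply/admissibleE => //; exists e; first by split=> //; lia.
by rewrite E; split=> //; lia.
Qed.

Lemma feasible_first_occ : feasible K w g i l -> 0 < m /\ arm_end K m l + g i.+1 <= i.
Proof.
case=> p [gap [/(admissibleE _ _ _ _ _ l0)[e [es pe] [sw le pr ge]] E]].
rewrite E /= in pr ge.
case em: m => [|e'].
  by have := first_occ0 em es; rewrite pr.
have [_ _ mn] := first_occP em; split=> //.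
have := arm_end_mono K l (mn _ es pr : e'.+1 <= e.+1).
lia.
Qed.

End FirstOcc.

(** * Text, construction loop and first occurrences *)

Definition src_atom (K : gapped_kind) : atom :=
  if K is Repeat then Mov rA rE else Minus rA rN rY2.

(** The number of letters of [full_text] after which the tree receives the leaf of [arm_text K w e];
    for palindromes the order is reversed. *)
Definition src (K : gapped_kind) (n e : nat) : nat := if K is Repeat then e.+1 else n - e.

Definition full_text (K : gapped_kind) (w : seq nat) : seq nat :=
  (if K is Repeat then w else rev w) ++ w.

Definition start : seq atom :=
  [:: Cst rOne 1; Cst rTwo 2; Plus rNN rN rN; Cst rLeaf 2; Cst rNew 3;
      Put LEN rTwo None rOne; Put PAR rTwo None rOne].

Definition copy (K : gapped_kind) : cmd :=
  Loop (Test false true rY2 rN)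
    (Sq (Blk [:: Plus rE rY2 rOne; Inp rC rE])
    (Sq (Blk [:: src_atom K])
        (Blk [:: Put TXT rA None rC; Plus rA rN rE; Put TXT rA None rC; Mov rY2 rE]))).

Definition build : cmd := Loop (Test false true rT rNN) insert.

Definition mark : cmd :=
  Loop (Test false false rQ rZero)
    (Blk [:: Put MIN rY None rE; Get rY PAR rY None; Get rQ MIN rY None]).

(** Node 1 receives a nonzero mark as a sentinel, which stops [mark] above the root. *)
Definition mark_all (K : gapped_kind) : cmd :=
  Sq (Blk [:: Put MIN rOne None rOne; Mov rY2 rZero])
     (Loop (Test false true rY2 rN)
       (Sq (Blk [:: Plus rE rY2 rOne])
       (Sq (Blk [:: src_atom K])
       (Sq (Blk [:: Get rY LEAF rA None; Get rQ MIN rY None])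
       (Sq mark (Blk [:: Mov rY2 rE])))))).

Definition input (w : seq nat) (g : nat -> nat) (i : nat) : nat :=
  if i <= size w then nth 0 w i.-1 else g (i - size w).

Lemma size_full_text K w : size (full_text K w) = size w + size w.
Proof. by case: K; rewrite size_cat ?size_rev. Qed.

Lemma nth_full_text_src K w e : e < size w ->
  nth 0 (full_text K w) (src K (size w) e).-1 = nth 0 w e.
Proof.
move=> ew; case: K; rewrite /full_text nth_cat ?size_rev /= ?ew //.
rewrite (_ : _ < _); last by lia.
by rewrite nth_rev; [congr nth; lia | lia].
Qed.

Lemma nth_full_text K w i : nth 0 (full_text K w) (size w + i) = nth 0 w i.
Proof.
rewrite nth_cat; have -> : size (if K is Repeat then w else rev w) = size w.
  by case: K; rewrite ?size_rev.
by rewrite ltnNge leq_addr /= addKn.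
Qed.

Lemma src_bounds K n e : e < n -> 0 < src K n e <= n.
Proof. by case: K => /=; lia. Qed.

Lemma arm_text_pref K w e : e < size w ->
  arm_text K w e = pref (full_text K w) (src K (size w) e).
Proof.
move=> ew; case: K; rewrite /pref /full_text /=.
  rewrite takel_cat ?size_rev ?leq_subr // take_rev revK subKn //; exact: ltnW.
by rewrite takel_cat.
Qed.

Lemma tables_ext cw ns x A A' :
  (forall a i j, a \in [:: LEN; POS; PAR; WLK; CHD] -> A' a i j = A a i j) ->
  tables cw ns x A -> tables cw ns x A'.
Proof.
move=> e [t0 t1 t2 t3 t4 t5 t6 t7 t8 t9 t10].
split=> [|u uN|u uN|u uN||u v cuv|d dx|u d uN|u v cuv|u a uN ni|i a hi]; rewrite !e //.
- exact: t1.
- exact: t2.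
- exact: t3.
- exact: t5.
- exact: t6.
- exact: t7.
- exact: t8.
- exact: t9.
- exact: t10.
Qed.

Lemma ok_src n inp K V A e k Q : V rY2 = e -> V rN = n -> V rE = e.+1 -> e < n -> 0 < k ->
  Q (State (upd V rA (src K n e)) A) k.-1 -> ok n inp (Blk [:: src_atom K]) (State V A) k Q.
Proof.
move=> v2 vN vE en k0 q; apply: ok_blk => //=; rewrite subn1.
case: K q => /= q; first by rewrite v2 vN; split=> //; rewrite /lim; lia.
by rewrite vE.
Qed.

Section Prepare.

Variables (K : gapped_kind) (w : seq nat) (g : nat -> nat).
Let n := size w.
Let cw := full_text K w.
Hypotheses (n0 : 0 < n) (wn : forall i, nth 0 w i <= n).

Let V0 (r : nat) := if r == 0 then n else 0.
Let A0 (a i j : nat) := 0.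

Lemma built0 V A : consts n V -> V rT = 0 -> V rLeaf = 2 -> V rNew = 3 -> text cw A ->
  (forall a i j, a != TXT -> A a i j = upd3 (upd3 A0 LEN 2 0 1) PAR 2 0 1 a i j) ->
  built n cw 0 [:: [::]] V A.
Proof.
move=> vc vt vl vn txt AE.
have nochild u v : ~ child [:: [::]] u v.
  by case=> _; rewrite inE => /eqP-> _; rewrite ltn0.
have pE : pref cw 0 = [::] by rewrite /pref take0.
split; rewrite ?pE //.
- split=> //.
  + by move=> u; rewrite inE => /eqP->.
  + by move=> u a b _; case: u.
- split=> //.
  + by rewrite AE.
  + by move=> u; rewrite inE => /eqP->; rewrite AE.
  + by move=> u; rewrite inE => /eqP->; rewrite AE.
  + by move=> u; rewrite inE => /eqP->; rewrite prefix0s.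
  + by rewrite AE.
  + by move=> u v /nochild.
  + by move=> u c; rewrite inE => /eqP->; rewrite AE.
  + by move=> u v /nochild.
  + by move=> u a; rewrite inE => /eqP->; rewrite AE.
  + by move=> i a _; rewrite !AE.
- by move=> i; lia.
- by move=> i j; rewrite AE.
Qed.

Lemma prepare_ok R k : 9 + 8 * n + R <= k ->
  ok n (input w g) (Sq (Blk start) (copy K)) (State V0 A0) k (fun st k' => exists V A,
    [/\ st = State V A, built n cw 0 [:: [::]] V A & R <= k']).
Proof.
move=> kR; have lN : n + n < lim n by rewrite /lim; lia.
apply: ok_blk_seq; first by rewrite /=; lia.
rewrite /= /upd /= /V0 /=; do 7!(split; first by lia).
pose A1 := upd3 (upd3 A0 LEN 2 0 1) PAR 2 0 1.
pose I st k' := exists V A e, [/\ st = State V A /\ e <= n,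
  [/\ consts n V, V rT = 0, V rLeaf = 2, V rNew = 3 & V rY2 = e],
  forall a i j, a != TXT -> A a i j = A1 a i j,
  forall e', e' < e -> A TXT (src K n e') 0 = nth 0 w e' /\ A TXT (n + e').+1 0 = nth 0 w e'
  & 8 * (n - e) + R + 1 <= k'].
apply: (ok_loop (I := I)).
- by move=> st k' [V [A [e [_ _ _ _]]]]; lia.
- move=> st k' [V [A [e [[-> en] [[vN vZ v1 v2 vNN] vT vL vN' vY2] AE Te cr]]]] /=.
  rewrite vY2 vN => len.
  have sb := src_bounds K len.
  have se : (if K is Repeat then e.+1 else n - e) = src K n e by [].
  have iE : input w g e.+1 = nth 0 w e by rewrite /input len.
  apply: ok_blk_seq; first by rewrite /=; lia.
  rewrite /= /upd /= vY2 v1 addn1 iE.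
  do 2!(split; first by lia).
  apply: ok_seq; apply: (@ok_src n _ K _ _ e) => //=; first by lia.
  apply: ok_blk; first by rewrite /=; lia.
  rewrite /= /upd /= vN; do 4!(split; first by move: lN; rewrite ?addnS; lia).
  set V3 := fun a' : nat => _; set A3 := upd3 _ _ _ _ _.
  exists V3, A3, e.+1; split; [by []|by split| |  |by rewrite /=; lia].
    by move=> a i j an; rewrite /A3 /upd3 (negbTE an) AE.
  move=> e' le'; rewrite /A3 /upd3 /= addnS.
  case: (ltngtP e' e) => [lt|gt|->]; [|by move: le'; lia|]; last first.
    by rewrite !eqxx; case: eqP.
  have [T1 T2] := Te _ lt; have sb' := src_bounds K (ltn_trans lt len).
  have s1 : (src K n e' == (n + e).+1) = false by apply/eqP; lia.
  have s2 : (src K n e' == src K n e) = false by apply/eqP; case: (K) => /=; lia.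
  have s3 : ((n + e').+1 == (n + e).+1) = false by apply/eqP; lia.
  have s4 : ((n + e').+1 == src K n e) = false by apply/eqP; lia.
  by rewrite s1 s2 s3 s4.
- move=> st k' [V [A [e [[-> en] [[vN vZ v1 v2 vNN] vT vL vN' vY2] AE Te cr]]]] /=.
  rewrite vY2 vN -leqNgt => le.
  have ee : e = n by apply/eqP; rewrite eqn_leq en.
  exists V, A; split=> //; last by lia.
  apply: built0 => // i; rewrite size_full_text => /andP[i0 i2].
  case: (leqP i n) => il.
    pose e' := if K is Repeat then i.-1 else n - i.
    have le' : e' < n by rewrite /e'; case: (K); lia.
    have si : src K n e' = i by rewrite /src /e'; case: (K); lia.
    have [] := Te e' _; rewrite ?ee // si => -> _.
    by rewrite -[in LHS](nth_full_text_src K le') -/n si.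
  have [|_ ] := Te (i - n).-1 _; first by rewrite ee; lia.
  have -> : (n + (i - n).-1).+1 = i by lia.
  by move=> ->; rewrite -(nth_full_text K); congr nth; lia.
- set V3 := fun a' : nat => _; exists V3, A1, 0; split=> //.
  by rewrite /=; lia.
Qed.

(** Thirteen of the 14 credits are the potential of the initial tree, which has one node; the last
    one is for the final test. A round takes the 95 of [insert] and a test. *)
Lemma build_ok V A R k : built n cw 0 [:: [::]] V A -> 14 + 96 * (n + n) + R <= k ->
  ok n (input w g) build (State V A) k (fun st k' => exists V A ns,
    [/\ st = State V A, built n cw (n + n) ns V A & R <= k']).
Proof.
move=> b kR; have scw : size cw = n + n := size_full_text K w.
have cwn i : nth 0 cw i < n.+2.
  case: (ltnP i (size cw)) => ic; last by rewrite nth_default.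
  have : nth 0 cw i \in w.
    have := mem_nth 0 ic; rewrite /cw mem_cat; case: (K); rewrite ?mem_rev; by case/orP.
  by move/(nthP 0) => [j _ <-]; apply: leq_trans (wn j) _.
pose I st k' := exists V A t ns, [/\ st = State V A, built n cw t ns V A, t <= n + n
  & 13 * potential ns (pref cw t) + 96 * (n + n - t) + R + 1 <= k'].
apply: (ok_loop (I := I)).
- by move=> st k' [V1 [A1 [t [ns [_ _ _]]]]]; lia.
- move=> st k' [V1 [A1 [t [ns [-> b1 tn cr]]]]] /=.
  have [vN vZ v1 v2 vNN] := bt_consts b1; rewrite vNN (bt_t b1) => tlt.
  apply: (ok_mono _ (@insert_ok n (input w g) cw t ns V1 A1 (96 * (n + n - t.+1) + R + 1) _ b1 _ scw cwn _)).
  + move=> s1 k1 [V2 [A2 [ns2 [-> b2 cr2]]]]; exists V2, A2, t.+1, ns2; split=> //.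
    by rewrite -!addnA; rewrite -!addnA in cr2.
  + by rewrite scw.
  + by lia.
- move=> st k' [V1 [A1 [t [ns [-> b1 tn cr]]]]] /=.
  have [vN vZ v1 v2 vNN] := bt_consts b1; rewrite vNN (bt_t b1) -leqNgt => tlt.
  have E : t = n + n by apply/eqP; rewrite eqn_leq tn.
  by exists V1, A1, ns; rewrite -E; split=> //; lia.
- exists V, A, 0, [:: [::]]; split=> //.
  by rewrite /potential /pref take0 /depth /=; lia.
Qed.

End Prepare.

(** * Earliest left arms at the nodes *)

Definition unmarked (A : nat -> nat -> nat -> nat) (m : nat) : nat :=
  count (fun i => A MIN i 0 == 0) (iota 2 m).

Lemma count_lt (T : eqType) (P Q : pred T) (s : seq T) i :
  (forall j, P j -> Q j) -> i \in s -> ~~ P i -> Q i -> count P s < count Q s.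
Proof.
move=> PQ; elim: s => //= j s IH; rewrite inE => /orP[/eqP<-|si] Pi Qi.
  by rewrite (negbTE Pi) Qi add0n add1n ltnS sub_count.
rewrite -addnS leq_add //; last exact: IH.
by have := PQ j; case: (P j) => // /(_ isT) ->.
Qed.

Lemma unmarked_lt A m i x : 1 < i < m.+2 -> A MIN i 0 = 0 -> 0 < x ->
  unmarked (upd3 A MIN i 0 x) m < unmarked A m.
Proof.
move=> im ai x0; apply: (@count_lt _ _ _ _ i).
- by move=> j; rewrite /upd3 /=; case: (j == i) => // /eqP e; rewrite e in x0.
- by rewrite mem_iota add2n.
- by rewrite /upd3 /= eqxx -lt0n.
- by rewrite ai.
Qed.

Section Mark.

Variables (K : gapped_kind) (w : seq nat) (inp : nat -> nat).
Let n := size w.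
Let cw := full_text K w.

Section MarkOne.

Variables (ns : seq (seq nat)) (x : seq nat) (e : nat).
Variables (V : nat -> nat) (A : nat -> nat -> nat -> nat) (R k : nat).
Let s := arm_text K w e.
Hypotheses (sh : tree_shape ns x) (tab : tables cw ns x A) (nsl : (size ns).+2 <= lim n).
Hypotheses (sN : s \in ns) (VZ : V rZero = 0) (VE : V rE = e.+1).
Hypotheses (VY : V rY = node_id ns s) (VQ : V rQ = A MIN (node_id ns s) 0).
Hypotheses (A1 : A MIN 1 0 = 1)
  (AM : forall u, u \in ns -> A MIN (node_id ns u) 0 = first_occ K w e u).
Hypothesis KR : 4 * unmarked A (size ns) + R + 1 <= k.

Lemma mark_ok : ok n inp mark (State V A) k (fun st k' => exists V' A',
  [/\ st = State V' A' /\ (forall r, r != rY -> r != rQ -> V' r = V r),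
      forall a i j, a != MIN -> A' a i j = A a i j, A' MIN 1 0 = 1,
      forall u, u \in ns -> A' MIN (node_id ns u) 0 = first_occ K w e.+1 u
    & 4 * unmarked A' (size ns) + R <= k']).
Proof.
have idl j : level ns s j -> 0 < level_id ns s j < lim n.
  by move=> lj; rewrite level_id_gt0 (leq_trans (level_id_lt lj)).
(* Level [j], the prefix of length [j - 1], is examined next; the longer prefixes of [s] are up to
   date. *)
pose I st k' := exists V' A' j, [/\ [/\ st = State V' A', j <= (size s).+1, level ns s j,
      V' rY = level_id ns s j & V' rQ = A' MIN (level_id ns s j) 0],
      forall r, r != rY -> r != rQ -> V' r = V r,
      forall a i j, a != MIN -> A' a i j = A a i j,
      A' MIN 1 0 = 1 /\ forall u, u \in ns -> A' MIN (node_id ns u) 0 =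
        if prefix u s && (j <= size u) then first_occ K w e.+1 u else first_occ K w e u
    & 4 * unmarked A' (size ns) + R + 1 <= k'].
apply: (ok_loop (I := I)).
- by move=> st k' [V' [A' [j [_ _ _ _]]]]; lia.
- move=> st k' [V' [A' [j [[-> js lj Vy Vq] fr AE [M1 M] cr]]]] /=.
  rewrite Vq fr // VZ => /eqP z.
  have j0 : 0 < j by case: (j) z => //=; rewrite M1.
  have tab' : tables cw ns x A'.
    by apply: tables_ext tab => a i i' ha; apply: AE; case: eqP ha => // ->.
  have [|j' [jj' lj' pj] nj'] := level_par sh tab' lj; first by rewrite j0.
  pose u0 := take j.-1 s.
  have u0N : u0 \in ns by move: lj; rewrite /level => /orP[/eqP e0|//]; rewrite e0 in j0.
  have id0 : level_id ns s j = node_id ns u0 by rewrite /level_id /u0; case: (j) j0.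
  have su0 : size u0 = j.-1 by rewrite size_takel // -ltnS prednK.
  have z0 : first_occ K w e u0 = 0.
    have := M _ u0N; rewrite -id0 z su0 leqNgt prednK // leqnn andbF //.
  have z1 : first_occ K w e.+1 u0 = e.+1.
    by rewrite first_occS z0 /= /u0 prefix_take.
  have um : unmarked (upd3 A' MIN (level_id ns s j) 0 e.+1) (size ns) < unmarked A' (size ns).
    by apply: unmarked_lt => //; rewrite id0 node_id_lt.
  apply: ok_blk; first by rewrite /=; lia.
  rewrite /= /upd /= Vy fr // VE {1 2}/upd3 /= pj !idl //.
  do 3!(split; first by []).
  set V3 := fun a' : nat => _; set A3 := upd3 _ _ _ _ _ in um *.
  exists V3, A3, j'; split.
  + split=> //; rewrite ?pj //; last by rewrite -pj.
    by apply: leq_trans (ltnW jj') js.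
  + by move=> r r1 r2; rewrite /V3 (negbTE r1) (negbTE r2) fr.
  + by move=> a i i' am; rewrite /A3 /upd3 (negbTE am) AE.
  + split=> [|u uN]; first by rewrite /A3 /upd3 /= id0.
    rewrite /A3 /upd3 /= id0 node_id_inj // M //.
    case: eqP => [->|ne].
      have jj : j' <= j.-1 by lia.
      have pu0 : prefix u0 s := prefix_take _ _.
      by rewrite pu0 su0 jj z1.
    congr (if _ then _ else _); case pu: (prefix u s) => //=.
    apply/idP/idP => h; first by lia.
    rewrite leqNgt; apply/negP => uj.
    have ut : u = take (size u) s by move: pu; rewrite prefixE => /eqP.
    case: (ltngtP (size u).+1 j) => c; [|by move: (leq_trans c uj); rewrite ltnn|].
      by have := nj' (size u).+1; rewrite ltnS h c /level /= -ut uN => /(_ isT).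
    by apply: ne; rewrite ut /u0 -c.
  + by rewrite /=; lia.
- move=> st k' [V' [A' [j [[-> js lj Vy Vq] fr AE [M1 M] cr]]]] /=.
  rewrite Vq fr // VZ => nz.
  exists V', A'; split=> //; last by lia.
  move=> u uN; rewrite M //; case: ifP => // h.
  rewrite first_occS; case: eqP => // z; case: ifP => // pu.
  rewrite pu /= in h.
  have j0 : 0 < j by case: (j) h.
  (* [u0] is the marked node that stopped the climb. It extends [u], so its earlier occurrence is
     also one of [u]. *)
  pose u0 := take j.-1 s.
  have u0N : u0 \in ns by move: lj; rewrite /level => /orP[/eqP e0|//]; rewrite e0 in j0.
  have id0 : level_id ns s j = node_id ns u0 by rewrite /level_id /u0; case: (j) j0.
  have su0 : size u0 = j.-1 by rewrite size_takel // -ltnS prednK.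
  move: nz; rewrite id0 M // su0 leqNgt prednK // leqnn andbF.
  case ef: (first_occ K w e u0) => [|m] // _.
  have [me pm _] := first_occP ef.
  case/negP: (first_occ0 z me); apply: prefix_trans pm.
  have ut : u = take (size u) s by move: pu; rewrite prefixE => /eqP.
  by rewrite ut /u0 -(take_takel s (_ : size u <= j.-1)) ?prefix_take //; lia.
- exists V, A, (size s).+1; split=> //.
  + by split; rewrite // /level /= take_size // sN orbT.
  + split=> // u uN; rewrite AM //; case: ifP => // /andP[pu su].
    by move: (leq_trans su (size_prefix pu)); rewrite ltnn.
Qed.

End MarkOne.

Lemma mark_all_ok ns V A R k : built n cw (n + n) ns V A -> (size ns).+2 <= lim n ->
  4 * size ns + 12 * n + R + 3 <= k ->
  ok n inp (mark_all K) (State V A) k (fun st k' => exists V' A',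
  [/\ st = State V' A' /\ consts n V',
      forall a i j, a != MIN -> A' a i j = A a i j,
      forall u, u \in ns -> A' MIN (node_id ns u) 0 = first_occ K w n u
    & R <= k']).
Proof.
move=> [sh tab _ vc _ _ _ txt lf mn] nsl kR.
have scw : size cw = n + n := size_full_text K w.
have [vN vZ v1 v2 vNN] := vc.
have ln : n + n < lim n by rewrite /lim; lia.
apply: ok_blk_seq; first by rewrite /=; lia.
rewrite /= /upd /= v1 vZ; split; first by split=> //; lia.
split=> //.
set V1 := fun a' : nat => _; set A1 := upd3 _ _ _ _ _.
pose I st k' := exists V' A' e, [/\ [/\ st = State V' A', consts n V', V' rY2 = e & e <= n],
      forall a i j, a != MIN -> A' a i j = A a i j, A' MIN 1 0 = 1,
      forall u, u \in ns -> A' MIN (node_id ns u) 0 = first_occ K w e u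
    & 4 * unmarked A' (size ns) + 8 * (n - e) + R + 1 <= k'].
apply: (ok_loop (I := I)).
- by move=> st k' [V' [A' [j [_ _ _ _]]]]; lia.
- move=> st k' [V' [A' [e [[-> vc' vy en] AE M1 M cr]]]] /=.
  have [vN' vZ' v1' v2' vNN'] := vc'.
  rewrite vy vN' => len; have sb := src_bounds K len; have [sb0 sbn] := andP sb.
  have sbnn : src K n e <= n + n by apply: leq_trans sbn (leq_addr _ _).
  have tab' : tables cw ns (pref cw (n + n)) A'.
    by apply: tables_ext tab => a i i' ha; apply: AE; case: eqP ha => // ->.
  have sN : arm_text K w e \in ns.
    by rewrite arm_text_pref //; apply: (pref_in sh); rewrite scw leqnn andbT.
  have le : A' LEAF (src K n e) 0 = node_id ns (arm_text K w e).
    by rewrite AE // lf ?arm_text_pref // sb0.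
  apply: ok_blk_seq; first by rewrite /=; lia.
  rewrite /= /upd /= vy v1' addn1; split; first by lia.
  apply: ok_seq; apply: (@ok_src n _ K _ _ e) => //=; first by lia.
  apply: ok_blk_seq; first by rewrite /=; lia.
  have il : node_id ns (arm_text K w e) < lim n by apply: leq_trans (node_id_lt sN) nsl.
  rewrite /= /upd /= le; split; first by split=> //; lia.
  split=> //.
  set V2 := fun a' : nat => _.
  apply: ok_seq; apply: (ok_mono _ (@mark_ok ns (pref cw (n + n)) e V2 A'
    (8 * (n - e) + R - 6) _ sh tab' nsl sN vZ' erefl erefl erefl M1 M _)); last first.
    by rewrite /=; lia.
  move=> s1 k1 [V3 [A3 [[-> fr3] AE3 M13 M3 cr3]]].
  apply: ok_blk; first by rewrite /=; lia.
  rewrite /=; split=> //.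
  exists (upd V3 rY2 (V3 rE)), A3, e.+1; split=> //.
  + split=> //; last by rewrite /upd /= fr3.
    by split; rewrite /upd /= fr3.
  + by move=> a i j am; rewrite AE3 // AE.
  + by rewrite /=; lia.
- move=> st k' [V' [A' [e [[-> vc' vy en] AE M1 M cr]]]] /=.
  have [vN' vZ' v1' v2' vNN'] := vc'.
  rewrite vy vN' -leqNgt => le.
  have E : e = n by apply/eqP; rewrite eqn_leq en.
  by exists V', A'; rewrite -[X in first_occ K w X]E; split=> //; lia.
- exists V1, A1, 0; split=> //.
  + by move=> a i j am; rewrite /A1 /upd3 (negbTE am).
  + by move=> u uN; rewrite /A1 /upd3 /= mn.
  + have : unmarked A1 (size ns) <= size (iota 2 (size ns)) by exact: count_size.
    by rewrite size_iota /=; lia.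
Qed.

End Mark.

(** * Sliding window *)

Definition end_atom (K : gapped_kind) : atom :=
  if K is Repeat then Mov rE rF else Plus rE rF rL.

(** After a failed extension the node in [rY] may be one letter longer than the window; then its
    parent is taken. At the end [rY] is the deepest node within the extended window and [rZ] the
    lower end of the edge where this window ends. *)
Definition locate : cmd :=
  Sq (Cond (Test false true rA rK) (Blk [:: Get rY PAR rY None]) (Blk [::]))
 (Sq climb
 (Sq (Blk [:: Mov rY rQ; Get rK LEN rY None; Plus rB rA rOne])
     (Cond (Test false false rK rB)
       (Blk [:: Mov rZ rY])
       (Blk [:: Plus rE rN rT1; Plus rE rE rOne; Minus rE rE rK; Get rE TXT rE None;
                Get rZ CHD rY (Some rE)])))).

Definition improve (K : gapped_kind) : cmd :=
  Sq (Blk [:: end_atom K])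
 (Sq (Blk [:: Minus rB rT1 rL; Plus rLz rN rB; Inp rP rLz; Plus rP rP rE])
     (Cond (Test false true rP rB)
       (Blk [:: Minus 1 rE rL; Minus rB rB rOne; Minus 3 rB rE; Mov 2 rA; Mov rL rA;
                Mov rFound rOne])
       (Blk [::]))).

(** The window only tests arms of length at least 1. For an empty arm the widest gap starts at the
    first letter, so it suffices to compare [g] at each position with that position. *)
Definition empty_arm : cmd :=
  Cond (Test false true rF rT1)
    (Cond (Test false false rFound rZero)
      (Blk [:: Mov 1 rOne; Mov 2 rZero; Mov 3 rT; Mov rFound rOne]) (Blk [::]))
    (Blk [::]).

Definition query_step (K : gapped_kind) : cmd :=
  Sq (Blk [:: Plus rT1 rT rOne; Plus rE rN rT1; Get rC TXT rE None; Inp rF rE;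
              Get rK LEN rY None; Plus rA rL rOne])
 (Sq empty_arm
 (Sq locate
 (Sq (Blk [:: Get rF MIN rZ None])
 (Sq (Cond (Test true false rF rZero) (improve K) (Blk [::]))
     (Blk [:: Mov rT rT1]))))).

Definition query (K : gapped_kind) : cmd :=
  Sq (Blk [:: Mov rY rTwo; Mov rL rZero; Mov rT rZero; Mov rFound rZero])
     (Loop (Test false true rT rN) (query_step K)).

(** No node ends inside an edge, so a node that begins with [take L.+1 s] reaches at least the lower
    end [v]. *)
Lemma locus ns x s k L : tree_shape ns x -> infix s x -> k < L.+1 <= size s ->
  take k s \in ns -> (forall j, k < j <= L.+1 -> take j s \notin ns) ->
  exists v, [/\ child ns (take k s) v, nth 0 v k = nth 0 s k &
    forall y, y \in ns -> prefix v y = prefix (take L.+1 s) y].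
Proof.
move=> sh sx /andP[kL Ls] kN above.
have ks : k < size s by lia.
have su : size (take k s) = k by rewrite size_takel // ltnW.
have kx : infix (rcons (take k s) (nth 0 s k)) x by rewrite -take_nth // infix_takel.
have [v cv vk] := child_ex sh kN kx; rewrite su in vk.
have [_ vN ue ul nb] := cv; rewrite su in ue ul nb.
have e1 : take k.+1 v = take k.+1 s by rewrite !(take_nth 0) // vk -ue.
have sE : take L.+1 s = take L.+1 v.
  have E j : j <= size s -> j <= size v -> take j s = take j v.
    by apply: (edge sh cv sx); rewrite su.
  case: (leqP L.+1 (size v)) => lv; first exact: E.
  have vs : size v <= size s by lia.
  have := above (size v); rewrite ul (ltnW lv) => /(_ isT).
  by rewrite E // take_size vN.
exists v; split=> // y yN; apply/idP/idP => pr.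
  by rewrite sE; apply: prefix_trans pr; exact: prefix_take.
have ky : k < size y by have := size_prefix pr; rewrite size_takel //; lia.
have ey : take L.+1 y = take L.+1 s.
  by move: pr; rewrite prefixE size_takel // => /eqP.
have E j : j <= size y -> j <= size v -> take j y = take j v.
  apply: (edge sh cv (shape_fac sh yN)); rewrite su // e1.
  exact: take_min ey.
case: (leqP (size v) (size y)) => vy.
  by rewrite prefixE E // take_size.
have := nb (size y); rewrite ky vy => /(_ isT).
by rewrite -E ?take_size ?yN // ltnW.
Qed.

Section Query.

Variables (K : gapped_kind) (w : seq nat) (g : nat -> nat).
Let n := size w.
Let cw := full_text K w.
Variables (ns : seq (seq nat)) (A : nat -> nat -> nat -> nat).
Let x := pref cw (n + n).
Hypotheses (sh : tree_shape ns x) (tab : tables cw ns x A) (txt : text cw A).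
Hypothesis nsl : (size ns).+2 <= lim n.
Hypothesis AM : forall u, u \in ns -> A MIN (node_id ns u) 0 = first_occ K w n u.
Hypothesis wn : forall i, nth 0 w i <= n.
Hypothesis gn : forall i, 0 < i <= n -> g i <= n.

Lemma pref_infix r : r <= n -> infix (pref w r) x.
Proof.
move=> rn; rewrite /x /pref [take (n + n) cw]take_oversize ?size_full_text //.
have E : rev w = rev (drop r w) ++ rev (take r w) by rewrite -rev_cat cat_take_drop.
rewrite /cw /full_text rev_cat E -catA.
exact: infix_infix.
Qed.

Lemma txt_w r : r < n -> A TXT (n + r).+1 0 = nth 0 w r.
Proof.
move=> rn; rewrite txt; last by rewrite size_full_text -/n; lia.
exact: nth_full_text.
Qed.

Lemma locate_ok V r L kq R k : r < n -> L <= r -> kq <= L.+1 -> kq <= r ->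
  consts n V -> V rT1 = r.+1 -> V rC = nth 0 w r -> V rA = L.+1 ->
  V rY = level_id ns (pref w r) kq.+1 -> V rK = kq.+1 ->
  take kq (pref w r) \in ns ->
  (forall j, kq < j <= L -> take j (pref w r) \notin ns) ->
  3 * depth ns (pref w r) kq.+1 + 18 + R <= k ->
  ok n (input w g) locate (State V A) k (fun st k' => exists V' k z,
    let s := pref w r.+1 in
    [/\ st = State V' A /\ k <= L.+1,
        take k s \in ns /\ V' rY = level_id ns s k.+1,
        forall j, k < j <= L.+1 -> take j s \notin ns,
        [/\ V' rZ = node_id ns z, z \in ns &
            forall y, y \in ns -> prefix z y = prefix (take L.+1 s) y]
      & (forall r, r \notin [:: rY; rQ; rK; rB; rE; rZ] -> V' r = V r) /\
        3 * depth ns s k.+1 + R <= k']).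
Proof.
move=> rn Lr kqL kqr vc vT vC vA vY vK kqN above kR.
have [vN vZ v1 v2 vNN] := vc.
set S := pref w r in vY kqN above kR.
have sS : size S = r by rewrite size_pref // ltnW.
have SE : pref w r.+1 = nth 0 w r :: S := prefS rn.
have cn : nth 0 w r < n.+2 by rewrite ltnS leqW.
have cx : nth 0 w r \in x.
  have := pref_infix rn; rewrite SE => /mem_infix; apply; exact: mem_head.
have c1 := tab_wlk0 tab cx.
have ln : n + n + n < lim n by rewrite /lim; lia.
have idl j : level ns S j -> 0 < level_id ns S j < lim n.
  by move=> lj; rewrite level_id_gt0 (leq_trans (level_id_lt lj)).
have lkq : level ns S kq.+1 by [].
have kqS : kq.+1 <= (size S).+1 by rewrite sS.
pose M st k' := exists V1 k0, [/\ [/\ st = State V1 A, k0 <= L.+1 & level ns S k0],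
  V1 rY = level_id ns S k0, forall j, k0 < j <= L.+1 -> take j (nth 0 w r :: S) \notin ns,
  forall r, r != rY -> V1 r = V r & 3 * depth ns S k0 + 16 + R <= k'].
have nk j k0 : (forall j, k0 < j <= L.+1 -> ~~ level ns S j) -> k0 < j <= L.+1 ->
    take j (nth 0 w r :: S) \notin ns.
  by move=> H /H; apply: contra; exact: (level_behead sh).
apply: ok_seq; apply: (@ok_mono _ _ _ _ _ M); last first.
  apply: ok_cond; first by lia.
  - rewrite /= vA vK => lt; have ekq : kq = L.+1 by lia.
    have [|k0 [lk0 lvk0 pk0] nk0] := level_par sh tab lkq; first by rewrite kqS.
    apply: ok_blk; first by rewrite /=; lia.
    rewrite /= /upd /= vY pk0 idl //; split=> //.
    set V1 := fun a' : nat => _; exists V1, k0; split=> //.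
    + by split=> //; lia.
    + by move=> j; apply: nk => i hi; apply: nk0; lia.
    + by move=> i ni; rewrite /V1 (negbTE ni).
    + by have := depth_le ns S (ltnW lk0); rewrite /=; lia.
  - rewrite /= vA vK => nlt; apply: ok_blk => //=.
    exists V, kq.+1; split=> //; last by lia.
      by split=> //; lia.
    move=> j; apply: nk => i /andP[i1 i2].
    by case: i i1 i2 => // i i1 i2; rewrite /level /= above //; lia.
move=> _ K1 [V1 [k0 [[-> k0L lk0] V1Y nk0 fr1 cr1]]].
have k0S : k0 <= (size S).+1 by rewrite sS; lia.
apply: ok_seq; apply: (ok_mono _ (@climb_ok n (input w g) cw ns x S (nth 0 w r) V1 A k0
  (14 + R) _ sh tab nsl cn c1 _ _ V1Y lk0 k0S _)).
- move=> _ K2 [V2 [k1 [[-> k1k0] [V2Y lk1] [k1N V2Q] nk1 [fr2 cr2]]]].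
  rewrite -SE in k1N V2Q nk1 nk0.
  have above1 j : k1 < j <= L.+1 -> take j (pref w r.+1) \notin ns.
    move=> /andP[j1 j2]; case: (leqP j k0) => jk; first by apply: nk1; rewrite j1.
    by apply: nk0; rewrite jk.
  have F r' : r' != rY -> r' != rQ -> V2 r' = V r'.
    by move=> r1 r2; rewrite fr2 // fr1.
  set s := pref w r.+1 in k1N V2Q nk1 nk0 above1 *.
  have ss : size s = r.+1 by rewrite size_pref.
  have k1L : k1 <= L.+1 by lia.
  have lenk : A LEN (node_id ns (take k1 s)) 0 = k1.+1.
    by rewrite (tab_len tab) // size_takel // ss; lia.
  have idk : node_id ns (take k1 s) < lim n by apply: leq_trans (node_id_lt k1N) nsl.
  have dep : depth ns s k1.+1 <= (depth ns S k1).+1 by rewrite /s SE; exact: (depth_cons _ _ _ sh).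
  apply: ok_blk_seq; first by rewrite /=; lia.
  rewrite /= /upd /= V2Q lenk !F // vA v1; do 3!(split; first by rewrite /=; lia).
  set V3 := fun a' : nat => _.
  have F3 r' : r' \notin [:: rY; rQ; rK; rB] -> V3 r' = V r'.
    rewrite !inE !negb_or => /and4P[a1 a2 a3 a4].
    by rewrite /V3 (negbTE a1) (negbTE a3) (negbTE a4) F.
  have V3K : V3 rK = k1.+1 by [].
  have V3B : V3 rB = L.+2 by rewrite /V3 /= addn1.
  have V3Y : V3 rY = node_id ns (take k1 s) by [].
  clearbody V3.
  apply: ok_cond; first by lia.
  + rewrite /= V3K V3B => /eqP[ek].
    apply: ok_blk; first by rewrite /=; lia.
    rewrite /= /upd /= V3Y; split=> //.
    set V4 := fun a' : nat => _; exists V4, k1, (take k1 s); split=> //.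
    * by split=> //; rewrite ek.
    * split; last by rewrite /=; lia.
      move=> r'; rewrite !inE !negb_or => /and5P[a1 a2 a3 a4 /andP[a5 a6]].
      by rewrite /V4 (negbTE a6) F3 // !inE !negb_or a1 a2 a3.
  + rewrite /= V3K V3B => nek.
    have k1L' : k1 < L.+1.
      by rewrite ltn_neqAle k1L andbT; apply: contra nek => /eqP->.
    have [|v [cv vk vP]] := locus sh (pref_infix rn) _ k1N above1.
      by rewrite -/s ss k1L' /=; lia.
    (* The letter after the node is letter [r - k1] of [w], read from the second half of the text,
       where [w] stands for both kinds. *)
    have tE : A TXT ((n + r.+1 + 1) - k1.+1) 0 = nth 0 v k1.
      have -> : (n + r.+1 + 1) - k1.+1 = (n + (r - k1)).+1 by lia.
      rewrite txt_w; last by lia.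
      rewrite vk /s /pref nth_rev_take; first by congr nth; lia.
      by rewrite -/n; lia.
    have [_ vN' _ _ _] := cv.
    have st : size (take k1 s) = k1 by rewrite size_takel // ss; lia.
    have vl : nth 0 v k1 < n.+2.
      by rewrite vk ltnS leqW // /s /pref nth_rev_take ?wn // -/n; lia.
    apply: ok_blk; first by rewrite /=; lia.
    rewrite /= /upd /= V3K V3Y !F3 // vN vT v1 tE; do 5!(split; first by rewrite /=; lia).
    set V4 := fun a' : nat => _; exists V4, k1, v; split=> //.
    * by split=> //; rewrite /V4 /= -[X in nth _ _ X]st (tab_chd tab cv).
    * split; last by rewrite /=; lia.
      move=> r'; rewrite !inE !negb_or => /and5P[a1 a2 a3 a4 /andP[a5 a6]].
      by rewrite /V4 (negbTE a5) (negbTE a6) F3 // !inE !negb_or a1 a2 a3.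
- by rewrite fr1.
- by rewrite fr1.
- by lia.
Qed.

End Query.

Section QueryLoop.

Variables (K : gapped_kind) (w : seq nat) (g : nat -> nat).
Let n := size w.
Let cw := full_text K w.
Variables (ns : seq (seq nat)) (A : nat -> nat -> nat -> nat).
Let x := pref cw (n + n).
Hypotheses (sh : tree_shape ns x) (tab : tables cw ns x A) (txt : text cw A).
Hypothesis nsl : (size ns).+2 <= lim n.
Hypothesis AM : forall u, u \in ns -> A MIN (node_id ns u) 0 = first_occ K w n u.
Hypothesis wn : forall i, nth 0 w i <= n.
Hypothesis gn : forall i, 0 < i <= n -> g i <= n.

(** Any admissible occurrence whose right arm starts at [r'.+1] gives [g r'.+1 < r'.+1], so the
    failure of these inequalities everywhere proves that none exists. *)
Definition found_inv (V : nat -> nat) (r L : nat) : Prop :=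
  if V rFound == 0 then L = 0 /\ forall r', r' < r -> ~~ (g r'.+1 < r'.+1)
  else V 2 = L /\ admissible K w g (V 1) L (V 3).

Lemma input_g i : 0 < i -> input w g (n + i) = g i.
Proof. by move=> i0; rewrite /input -/n (_ : n + i <= n = false) ?addKn //; lia. Qed.

Lemma empty_arm_ok V r L k Q : r < n -> consts n V -> V rF = g r.+1 -> V rT1 = r.+1 -> V rT = r ->
  found_inv V r L -> 6 <= k ->
  (forall V' k', found_inv V' r.+1 L -> k <= k' + 6 ->
    (forall q, q \notin [:: 1; 2; 3; rFound] -> V' q = V q) -> Q (State V' A) k') ->
  ok n (input w g) empty_arm (State V A) k Q.
Proof.
move=> rn [vN vZ v1 v2 vNN] vF vT1 vT fi k6 H.
apply: ok_cond; first by lia.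
- rewrite /= vF vT1 => gr; apply: ok_cond; first by lia.
  + rewrite /= vZ => f0; apply: ok_blk; first by rewrite /=; lia.
    rewrite /= /upd /=; do 4!split=> //.
    apply: H; last 2 first.
    * by rewrite /=; lia.
    * by move=> q; rewrite !inE !negb_or => /and4P[a1 a2 a3 a4];
      rewrite (negbTE a1) (negbTE a2) (negbTE a3) (negbTE a4).
    rewrite /found_inv /= v1 vZ vT; move: fi; rewrite /found_inv f0 => -[-> _]; split=> //.
    split; [apply/gapped_factorE; split=> //= | by rewrite addn0 add1n | by rewrite addn0 add1n].
      by rewrite /= -/n; lia.
    by rewrite !take0; case: (K).
  + rewrite /= vZ => f1; apply: ok_blk => //=.
    by apply: H => //; [move: fi; rewrite /found_inv (negbTE f1) | lia].
- rewrite /= vF vT1 => gr; apply: ok_blk => //=.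
  apply: H => //; last by lia.
  move: fi; rewrite /found_inv; case: ifP => // _ [-> Hr]; split=> // r'.
  by rewrite ltnS leq_eqVlt => /orP[/eqP->|/Hr].
Qed.

Lemma improve_ok V r L m k Q : r < n -> L <= r -> consts n V -> V rF = m -> m <= n ->
  V rT1 = r.+1 -> V rL = L -> V rA = L.+1 -> 14 <= k ->
  let i := r - L in let E := arm_end K m L.+1 in L < E ->
  (E + g i.+1 <= i -> forall V' k', k <= k' + 14 ->
    [/\ V' 1 = E - L, V' 2 = L.+1, V' 3 = i - E, V' rL = L.+1 & V' rFound = 1] ->
    (forall q, q \notin [:: rE; rB; rLz; rP; 1; 2; 3; rL; rFound] -> V' q = V q) ->
    Q (State V' A) k') ->
  (~~ (E + g i.+1 <= i) -> forall V' k', k <= k' + 14 ->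
    (forall q, q \notin [:: rE; rB; rLz; rP] -> V' q = V q) -> Q (State V' A) k') ->
  ok n (input w g) (improve K) (State V A) k Q.
Proof.
move=> rn Lr [vN vZ v1 v2 vNN] vF mn vT1 vL vA k14 i E /ltnW LE H1 H2.
have En : E <= n + n by rewrite /E; case: (K) => /=; lia.
have ln : n + n + n + n < lim n by rewrite /lim; lia.
apply: ok_seq.
suff main V1 : V1 rE = E -> (forall q, q != rE -> V1 q = V q) ->
    ok n (input w g) (Sq (Blk [:: Minus rB rT1 rL; Plus rLz rN rB; Inp rP rLz; Plus rP rP rE])
     (Cond (Test false true rP rB)
       (Blk [:: Minus 1 rE rL; Minus rB rB rOne; Minus 3 rB rE; Mov 2 rA; Mov rL rA;
                Mov rFound rOne])
       (Blk [::]))) (State V1 A) k.-1 Q.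
  apply: ok_blk => /=; first by lia.
  rewrite subn1 /end_atom; move: main; rewrite /E; case: (K) => /= main.
    rewrite vF vL; split; first by lia.
    by apply: main => [|q nq]; rewrite /upd /= ?(negbTE nq) //; lia.
  by split=> //; apply: main => [|q nq]; rewrite /upd /= ?(negbTE nq).
move=> vE fr.
have gi : input w g (n + (r.+1 - L)) = g i.+1 by rewrite input_g ?subSn //; lia.
have gb : g i.+1 <= n by apply: gn; rewrite /i; lia.
apply: ok_blk_seq; first by rewrite /=; lia.
have [f1 f2 f3] : [/\ V1 rT1 = r.+1, V1 rL = L & V1 rN = n] by split; rewrite fr.
rewrite /= /upd /= f1 f2 f3 vE gi; do 4!(split; first by rewrite /=; lia).
set V2 := fun a' : nat => _.
have V2P : V2 rP = g i.+1 + E by [].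
have V2B : V2 rB = r.+1 - L by [].
have V2E : V2 rE = E by rewrite -vE.
have fr2 q : q \notin [:: rE; rB; rLz; rP] -> V2 q = V q.
  rewrite !inE !negb_or => /and4P[a1 a2 a3 a4].
  by rewrite /V2 (negbTE a2) (negbTE a3) (negbTE a4) fr.
clearbody V2.
apply: ok_cond; first by lia.
- rewrite /= V2P V2B => lt; have ge : E + g i.+1 <= i by move: lt; rewrite (subSn Lr) addnC.
  apply: ok_blk; first by rewrite /=; lia.
  have [f4 f5 f6] : [/\ V2 rL = L, V2 rA = L.+1 & V2 rOne = 1] by split; rewrite fr2.
  rewrite /= /upd /= V2E V2B f4 f5 f6.
  do 6!(split; first by rewrite /=; lia).
  apply: H1 => //; first by rewrite /=; lia.
    by split=> //=; rewrite /i; lia.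
  move=> q; rewrite !inE !negb_or => /and5P[a1 a2 a3 a4 /and5P[a5 a6 a7 a8 a9]].
  rewrite (negbTE a2) (negbTE a5) (negbTE a6) (negbTE a7) (negbTE a8) (negbTE a9).
  by rewrite fr2 // !inE !negb_or a1 a2 a3.
- rewrite /= V2P V2B => nlt; have nge : ~~ (E + g i.+1 <= i) by move: nlt; rewrite (subSn Lr) addnC.
  by apply: ok_blk => //=; apply: H2 => //; lia.
Qed.


Lemma query_ok V R k : consts n V -> 64 * n + 10 + R <= k ->
  ok n (input w g) (query K) (State V A) k (fun st k' => exists V',
    [/\ st = State V' A,
        if V' rFound == 0 then forall p l m, ~ admissible K w g p l m
        else longest_admissible K w g (V' 1) (V' 2) (V' 3)
      & R <= k']).
Proof.
move=> [vN vZ v1 v2 vNN] kR.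
have ln : n + n + n + n < lim n by rewrite /lim; lia.
have nln : n < lim n by lia.
apply: ok_blk_seq; first by rewrite /=; lia.
rewrite /= /upd /=; do 4!split=> //.
set V0 := fun a' : nat => _.
(* [kq] is the length of the stored node and may exceed [L] by one. The starts with [i + L < r] are
   those whose window of length [L.+1] ends within the letters read so far. The term in [depth] pays
   for the climbs. *)
pose I st k' := exists V r L kq, [/\
  [/\ st = State V A, r <= n, L <= r, kq <= r & kq <= L.+1],
  [/\ consts n V, V rT = r, V rL = L & V rY = level_id ns (pref w r) kq.+1],
  take kq (pref w r) \in ns /\ forall j, kq < j <= L -> take j (pref w r) \notin ns,
  found_inv V r L /\ forall i, i + L < r -> ~ feasible K w g i L.+1
  & 3 * depth ns (pref w r) kq.+1 + 64 * (n - r) + R + 1 <= k'].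
apply: (ok_loop (I := I)).
- by move=> st k' [V1 [r [L [kq [_ _ _ _]]]]]; lia.
- move=> st k' [V1 [r [L [kq [[-> rn' Lr kqr kqL] [vc1 vT vL vY] [kqN nk] [fi ub] cr]]]]].
  have [wN wZ w1 w2 wNN] := vc1.
  rewrite /= vT wN => rn.
  have sr : size (pref w r) = r by exact: size_pref.
  have lkq : level ns (pref w r) kq.+1 by [].
  have lid : level_id ns (pref w r) kq.+1 < lim n by apply: leq_trans (level_id_lt lkq) nsl.
  have len := level_len tab lkq.
  rewrite sr ltnS in len.
  apply: ok_blk_seq; first by rewrite /=; lia.
  have txw := txt_w txt nsl rn.
  have inr : input w g (n + r.+1) = g r.+1 by exact: input_g.
  rewrite /= /upd /= vT wN vY w1 vL !addn1 len // addnS txw -addnS inr.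
  have lid0 := level_id_gt0 ns (pref w r) kq.+1.
  split; first by lia.
  split; first by lia.
  split; first by lia.
  split; first by lia.
  split; first by rewrite lid0 lid.
  split; first by lia.
  set V2 := fun a' : nat => _.
  have f2 : found_inv V2 r L by [].
  have c2 : consts n V2 by [].
  have [V2T1 V2C V2F V2K] : [/\ V2 rT1 = r.+1, V2 rC = nth 0 w r, V2 rF = g r.+1 & V2 rK = kq.+1].
    by [].
  have [V2A V2T V2L V2Y] : [/\ V2 rA = L.+1, V2 rT = r, V2 rL = L &
    V2 rY = level_id ns (pref w r) kq.+1] by [].
  clearbody V2.
  apply: ok_seq; apply: (empty_arm_ok rn c2 V2F V2T1 V2T f2); first by lia.
  move=> V3 k3 f3 kk3 fr3.
  have c3 : consts n V3 by case: c2 => *; split; rewrite fr3.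
  apply: ok_seq; apply: (ok_mono _ (@locate_ok K w g ns A sh tab txt nsl wn V3 r L kq
    (64 * (n - r) + R - 35) _ rn Lr kqL kqr c3 _ _ _ _ _ kqN nk _)); rewrite ?fr3 //; last by lia.
  move=> _ k4 [V4 [k1 [z [[-> k1L] [k1N V4Y] nk1 [V4Z zN zP] [fr4 cr4]]]]].
  set s := pref w r.+1 in k1N V4Y nk1 zP cr4.
  have ss : size s = r.+1 by exact: size_pref.
  pose u := take L.+1 s.
  have uE : u = rev (take L.+1 (drop (r - L) w)).
    rewrite /u /s /pref take_rev size_takel // take_drop.
    by congr (rev (drop _ (take _ _))); lia.
  have mz : A MIN (node_id ns z) 0 = first_occ K w n u.
    rewrite AM //; apply: eq_first_occ => e en; apply: zP.
    rewrite arm_text_pref //; apply: (pref_in sh); rewrite size_full_text leqnn andbT.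
    by have := src_bounds K en; rewrite -/n; lia.
  set m := first_occ K w n u in mz.
  have mn : m <= n.
    by rewrite /m; case em: (first_occ K w n u) => [|m'] //; case: (first_occP em).
  have il : (r - L) + L.+1 <= size w by rewrite -/n; lia.
  have fea := @feasible_first_occ K w g (r - L) L.+1 isT il.
  have adm := @first_occ_admissible K w g (r - L) L.+1 isT il.
  rewrite -uE -/n -/m in fea adm.
  have zl : node_id ns z < lim n by apply: leq_trans (node_id_lt zN) nsl.
  apply: ok_blk_seq; first by rewrite /=; lia.
  rewrite /= /upd /= V4Z mz; split=> //.
  set V5 := fun a' : nat => _.
  have V5F : V5 rF = m by [].
  have fr5 q : q \notin [:: rY; rQ; rK; rB; rE; rZ; rF] -> V5 q = V3 q.
    rewrite !inE !negb_or => /and5P[a1 a2 a3 a4 /and3P[a5 a6 a7]].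
    by rewrite /V5 (negbTE a7) fr4 // !inE !negb_or a1 a2 a3 a4 a5.
  have V5Y : V5 rY = level_id ns s k1.+1 by rewrite -V4Y.
  clearbody V5.
  have c5 : consts n V5 by case: c3 => *; split; rewrite fr5.
  have f5 : found_inv V5 r.+1 L by move: f3; rewrite /found_inv !fr5.
  pose M st k' := exists V' L', [/\ st = State V' A /\ [/\ V' rY = level_id ns s k1.+1,
      V' rT1 = r.+1, V' rL = L' & consts n V'],
      L <= L' <= L.+1, found_inv V' r.+1 L',
      forall i, i + L' < r.+1 -> ~ feasible K w g i L'.+1
    & 3 * depth ns s k1.+1 + 64 * (n - r) + R - 62 <= k'].
  have upfail : ~ feasible K w g (r - L) L.+1 -> forall i, i + L < r.+1 -> ~ feasible K w g i L.+1.
    move=> nf i; rewrite ltnS leq_eqVlt => /orP[/eqP e|/ub //].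
    by rewrite -e addnK in nf.
  apply: ok_seq; apply: (@ok_mono _ _ _ _ _ M).
    move=> _ k6 [V6 [L6 [[-> [V6Y V6T V6L c6]] /andP[LL6 L6L] f6 ub6 cr6]]].
    apply: ok_blk; first by rewrite /=; lia.
    rewrite /= /upd /=; split=> //.
    set V7 := fun a' : nat => _.
    exists V7, r.+1, L6, k1; split=> //.
    + by split=> //; lia.
    + by split=> // j hj; apply: nk1; lia.
    + by rewrite -/s /=; lia.
  have c5Z : V5 rZero = 0 by case: c5.
  apply: ok_cond; first by lia.
  - rewrite /= V5F c5Z -lt0n => m0.
    have Em : L < arm_end K m L.+1.
      case em: (first_occ K w n u) => [|m']; first by move: m0; rewrite /m em.
      have [_ pr _] := first_occP em; rewrite /m em.
      by apply: arm_end_ge pr => //; rewrite size_takel // ss; lia.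
    apply: (@improve_ok V5 r L m) => //; rewrite ?fr5 ?fr3 //; first by lia.
    + move=> ge V6 k6 kk6 [a1 a2 a3 a4 a5] fr6.
      have [_ ad] := adm m0 ge.
      have c6 : consts n V6 by case: c5 => *; split; rewrite fr6.
      exists V6, L.+1; split.
      * by split=> //; split=> //; rewrite fr6 ?V5Y // fr5 // fr3.
      * by rewrite leqnSn leqnn.
      * by rewrite /found_inv a5 /= a1 a2 a3; split=> //; move: ad; rewrite subSS.
      (* Starts given up at the old length are infeasible at the new one a fortiori. *)
      * move=> i; rewrite addnS ltnS => /ub nf /feasible_pred; exact: nf.
      * by lia.
    + move=> nge V6 k6 kk6 fr6.
      have c6 : consts n V6 by case: c5 => *; split; rewrite fr6.
      exists V6, L; split.
      * by split=> //; split=> //; rewrite fr6 ?V5Y // fr5 // fr3.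
      * by rewrite leqnn leqnSn.
      * by move: f5; rewrite /found_inv !fr6.
      * by apply: upfail => /fea [_ ge]; rewrite ge in nge.
      * by lia.
  - rewrite /= V5F c5Z => /negPn/eqP m0.
    apply: ok_blk => //=; exists V5, L; split.
    + by split=> //; split=> //; rewrite fr5 // fr3.
    + by rewrite leqnn leqnSn.
    + by [].
    + by apply: upfail => /fea []; rewrite m0.
    + by lia.
- move=> st k' [V1 [r [L [kq [[-> rn' Lr kqr kqL] [vc1 vT vL vY] _ [fi ub] cr]]]]].
  have [wN wZ w1 w2 wNN] := vc1.
  rewrite /= vT wN -leqNgt => nr.
  have rE : r = n by apply/eqP; rewrite eqn_leq rn'.
  rewrite rE in fi ub.
  exists V1; split=> //; last by lia.
  move: fi; rewrite /found_inv; case: ifP => _.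
    move=> [_ H] p l m [/gapped_factorE[p0 sw _] plm gm].
    have := H (p + l + m).-1; rewrite prednK; last by lia.
    rewrite -/n in plm; move/(_ plm); case/negP; apply: leq_ltn_trans gm _; lia.
  move=> [-> ad]; split=> // p l m ad'; rewrite leqNgt; apply/negP => Ll.
  have [/gapped_factorE[p0 sw _] plm gm] := ad'.
  have E : p + l + m = (p + l + m).-1.+1 by rewrite prednK //; lia.
  have f : feasible K w g (p + l + m).-1 l by exists p, m.
  have {}f : feasible K w g (p + l + m).-1 L.+1.
    exact: feasible_le Ll f.
  by apply: (ub (p + l + m).-1) f; rewrite /n; lia.
- exists V0, 0, 0, 0; split=> //.
  + by split=> //; rewrite /V0 /= v2 -(shape_nil sh) /pref take0.
  + by rewrite take0 (shape_nil_in sh); split=> // j; lia.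
  + by split=> //; rewrite /found_inv /V0 /= vZ.
  + have : depth ns (pref w 0) 1 <= 1 by rewrite /depth /= addn0 leq_b1.
    by rewrite /=; lia.
Qed.

End QueryLoop.

(** * The whole program *)

Definition solve (K : gapped_kind) : cmd :=
  Sq (Sq (Blk start) (copy K))
 (Sq build
 (Sq (mark_all K)
 (Sq (query K)
     (Blk [:: Mov 0 rFound])))).

(** Two instructions load [n + 2] into register 32, whence the offset 2. *)
Definition machine (K : gapped_kind) : program :=
  [:: Const 33 2; Op Add 32 0 33] ++ compile 2 (solve K).

(** The phases need [292 n + 41] credits together, which is below [340 n] since [n] is positive. *)
Lemma solve_ok K w g : 0 < size w -> (forall i, nth 0 w i <= size w) ->
  (forall i, 0 < i <= size w -> g i <= size w) ->
  ok (size w) (input w g) (solve K)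
    (State (fun r => if r == 0 then size w else 0) (fun _ _ _ => 0)) (340 * size w)
    (fun st _ => if var st 0 == 0 then forall p l m, ~ admissible K w g p l m
                 else longest_admissible K w g (var st 1) (var st 2) (var st 3)).
Proof.
move=> n0 wn gn; set n := size w in n0 wn gn *.
pose R3 := 64 * n + 11; pose R2 := 16 * n + 4 + 12 * n + R3 + 3.
apply: ok_seq; apply: (ok_mono _ (@prepare_ok K w g n0 (14 + 96 * (n + n) + R2) _ _)); last first.
  by rewrite /R2 /R3 -/n; lia.
move=> _ k1 [V1 [A1 [-> b1 le1]]].
apply: ok_seq; apply: (ok_mono _ (@build_ok K w g n0 wn V1 A1 R2 k1 b1 le1)).
move=> _ k2 [V2 [A2 [ns [-> b2 le2]]]].
have sn := bt_size b2.
have sn4 : 4 * size ns <= 16 * n + 4 by rewrite -addnn in sn; lia.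
have nsl : (size ns).+2 <= lim n by move: sn; rewrite -addnn /lim; lia.
have lek : 4 * size ns + 12 * n + R3 + 3 <= k2.
  by apply: leq_trans le2; rewrite /R2 !leq_add2r.
apply: ok_seq; apply: (ok_mono _ (@mark_all_ok K w (input w g) ns V2 A2 R3 k2 b2 nsl lek)).
move=> _ k3 [V3 [A3 [[-> c3] AE3 M3 le3]]].
have tab3 : tables (full_text K w) ns (pref (full_text K w) (n + n)) A3.
  by apply: tables_ext (bt_tab b2) => a i j ha; apply: AE3; case: eqP ha => // ->.
have txt3 : text (full_text K w) A3 by move=> i hi; rewrite AE3 // (bt_text b2).
apply: ok_seq; apply: (ok_mono _ (@query_ok K w g ns A3 (bt_shape b2) tab3 txt3 nsl M3 wn gn
  V3 1 k3 c3 _)); last by rewrite -addnA.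
move=> _ k4 [V4 [-> res le4]].
by apply: ok_blk => //=; split.
Qed.

(** The left side is less than [n.+1 ^ 2 * 2 ^ 10], and [2 <= n.+1] bounds this by [n.+1 ^ 12]. *)
Lemma word_size_big n : 0 < n -> (lim n * n.+2 + n.+2) * 16 + 16 < 2 ^ word_size 12 n.
Proof.
move=> n0; rewrite /word_size /lim [12 * _]mulnC expnM.
apply: (@leq_trans (n.+1 ^ 12)); last first.
  by rewrite leq_exp2r // up_logP.
apply: (@leq_trans (n.+1 ^ 2 * 2 ^ 10)); last first.
  by rewrite (expnD _ 2 10) leq_mul2l leq_exp2r // ltnS n0 orbT.
have -> : 2 ^ 10 = 1024 by [].
rewrite expnS expn1; nia.
Qed.

Theorem theorem17 (K : gapped_kind) :
  exists (P : program) (k C : nat),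
    0 < k /\
    forall (n : nat) (w : seq nat) (g : nat -> nat),
      0 < n ->
      size w = n ->
      (forall a, a \in w -> 1 <= a <= n) ->
      (forall i, 1 <= i <= n -> 1 <= g i <= n) ->
      exists t : nat,
        let s := steps (word_size k n) P t (init_config w g) in
        [/\ t <= C * n, halted P s & reports_longest K w g s].
Proof.
(* 2722 is 8 steps for each of [340 n] credits, plus the two initial instructions. *)
exists (machine K), 12, 2722; split=> // n w g n0 sw wn gn.
have wn' i : nth 0 w i <= size w.
  case: (ltnP i (size w)) => iw; last by rewrite nth_default.
  by rewrite sw; have /andP[] := wn _ (mem_nth 0 iw).
have gn' i : 0 < i <= size w -> g i <= size w by rewrite sw => /gn /andP[].
subst n; set n := size w in n0 *; set b := word_size 12 n.
have big := word_size_big n0.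
have [k1 [[V A] [r le1 q]]] := solve_ok K n0 wn' gn'.
have okc : cmd_ok (solve K) by case: (K).
have lb : n.+2 < 2 ^ b by apply: leq_ltn_trans big; nia.
pose Ri := reg (init_config w g).
pose R0 := upd (upd Ri 33 (2 %% 2 ^ b)) 32 ((n + 2 %% 2 ^ b) %% 2 ^ b).
pose M0 := Defs.mem (init_config w g).
(* The arrays lie beyond the input cells, where the memory is initially 0, so they start blank at no
   cost. *)
have S0 : sim n (input w g) (State (fun r => if r == 0 then n else 0) (fun _ _ _ => 0)) R0 M0.
  split=> //.
  - move=> r' lr; rewrite /R0 /upd; case: eqP => [e|_]; first by rewrite e in lr.
    by case: eqP => // e; rewrite e in lr.
  - have b2 : 2 < 2 ^ b by lia.
    by rewrite /R0 /upd /= (modn_small b2) addn2 modn_small.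
  - move=> a i j _ /andP[i0 _] _.
    have ag : n + n < addr n a i j by exact: (addr_gt big).
    rewrite /M0 /= -/n (_ : addr n a i j <= n = false); last by lia.
    by rewrite andbF (_ : addr n a i j <= n + n = false) ?andbF //; lia.
  - move=> i /andP[i0 i2]; rewrite /M0 /input /= -/n i0 i2 andbT.
    by rewrite ltnNge; case: (i <= n).
have sc : subcode (machine K) 2 (compile 2 (solve K)).
  by exists [:: Const 33 2; Op Add 32 0 33], [::]; split=> //; rewrite cats0.
have [t [R [M [lt E S]]]] := runs_sim big r okc S0 sc.
exists (t + 2).
have E0 : steps b (machine K) 2 (init_config w g) = Config 2 R0 M0.
  by [].
rewrite /steps iterD -/(steps _ _ 2 _) E0 -/(steps _ _ t _) E.
split.
- by move: lt le1; rewrite -/n; lia.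
- by rewrite /halted [pc _]/= /machine size_cat size_compile.
- case: S => sR _ _ _; by rewrite /reports_longest /= !sR.
Qed.
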